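(* Let $\theta=\sum_{i=1}^\infty2^{-2^{2i}}$ and let $F_0:[0,1]\times\mathcal T^1\to[0,1]\times\mathcal T^1$, $F_0(x,y)=(T_0(x),G_0(x,y))$, with $T_0(x)=2x\bmod1$, $G_0(x,y)=y+\theta\varphi(x)$, $\varphi=\chi_{[\frac12,1]}$. For $j\ge1$ let $\delta_j=\sum_{i=j+1}^\infty2^{-2^{2i}}$, let $\hat F_{\delta_j}$ be the perturbations of $F_0$ described in the context, and let $\mu_j$ be their invariant (probability) measures in $\mathcal L^1$. Let $\mu_0$ be the Lebesgue measure on $[0,1]\times\mathcal T^1$. Then there are an observable $\psi:[0,1]\times\mathcal T^1\to\mathbb R$ with derivative in $L^2$ and a constant $C>0$ such that $$\left|\int\psi\,d\mu_0-\int\psi\,d\mu_j\right|\ge C\sqrt{\delta_j}.$$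
   Context: **The perturbations.** $\mathcal T^1=\mathbb R/\mathbb Z$. Let $\theta_j=\theta-\delta_j=\sum_{i=1}^j2^{-2^{2i}}$ and $k_j=2^{2^{2j}}$; the orbit of $0$ under the rotation $y\mapsto y+\theta_j$ of $\mathcal T^1$ is periodic of period $k_j$; denote its points, in cyclic order on the circle, by $y_1=0,y_2,\dots,y_{k_j}$ (they are the multiples of $1/k_j$), with $y_{k_j+1}=y_1$. Let $g=g_j:\mathcal T^1\to\mathbb R$ be a $C^\infty$ function with $|g|\le1$ such that $g$ is negative inside each interval $[y_i,y_i+\frac1{2k_j}]$ and positive inside each interval $[y_i+\frac1{2k_j},y_{i+1}]$ (so $g(y_i)=g(y_i+\frac1{2k_j})=0$), and $g'$ is positive in each interval $[y_i+\frac1{3k_j},y_{i+1}-\frac1{3k_j}]$ and negative in $[y_i,y_{i+1}]$ minus that interval. Put $D_{\delta_j}(y)=y+\delta_jg(y)\bmod1$ and $$\hat F_{\delta_j}(x,y)=\big(T_0(x),\ D_{\delta_j}(y+\theta_j\varphi(x))\big).$$ **The space $\mathcal L^1$.** For a finite signed Borel measure $\nu$ on $\mathcal T^1$, $\|\nu\|_{W_1}=\sup\{|\int h\,d\nu|:\mathrm{Lip}(h)\le1,\ \|h\|_\infty\le1\}$. For a positive Borel measure $\mu$ on $[0,1]\times\mathcal T^1$ whose projection on $[0,1]$ is absolutely continuous with density $\phi_\mu$ (with respect to Lebesgue measure $m$), with disintegration $\{\mu_s\}_{s\in[0,1]}$ into probability measures on the leaves $\{s\}\times\mathcal T^1$,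 $\mu|_s$ is the measure on $\mathcal T^1$ equal to $\phi_\mu(s)$ times the image of $\mu_s$ under $(s,y)\mapsto y$. $\mathcal L^1$ is the set of signed Borel measures $\mu=\mu^+-\mu^-$ (Jordan decomposition) on $[0,1]\times\mathcal T^1$ such that the projections of $\mu^\pm$ on $[0,1]$ are absolutely continuous and $\int_{[0,1]}\|\mu^+|_s-\mu^-|_s\|_{W_1}\,dm(s)<\infty$. *)

(* Defs.v *)
(* The circle R/Z is represented by its fundamental domain
   [0,1[ ("frac" is the projection R -> [0,1[), a function on the circle by a
   1-periodic function on R, and a Borel measure on [0,1] x R/Z by a Borel
   measure on R x R that is concentrated on "cylinder" = [0,1] x [0,1[. *)

From HB Require Import structures.
From mathcomp Require Import all_boot all_order all_algebra.
From mathcomp Require Import all_classical all_reals all_analysis.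

Set Implicit Arguments.
Unset Strict Implicit.
Unset Printing Implicit Defensive.

Import Order.TTheory GRing.Theory Num.Theory.
Import numFieldNormedType.Exports.

Local Open Scope classical_set_scope.
Local Open Scope ring_scope.

Section Angles.
Context (R : realType).

Definition theta_term (i : nat) : R := 2 ^- (2 ^ (2 * i)).

Definition theta : R := limn (fun n => \sum_(1 <= i < n) theta_term i).

Definition delta (j : nat) : R :=
  limn (fun n => \sum_(j.+1 <= i < n) theta_term i).

Definition theta_ (j : nat) : R := \sum_(1 <= i < j.+1) theta_term i.

Definition period (j : nat) : nat := (2 ^ (2 ^ (2 * j)))%N.

(* For 0 <= i < period j these are the points, in cyclic order and starting
   with 0, of the orbit of 0 under the rotation by theta_ j; the index is
   shifted by one (the first point has index 0), and orbit_pt j (period j) = 1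
   is the first point again. *)
Definition orbit_pt (j i : nat) : R := i%:R / (period j)%:R.

End Angles.

Section Maps.
Context (R : realType).

Definition frac (x : R) : R := x - (Num.floor x)%:~R.

Definition periodic1 (g : R -> R) : Prop := forall y, g (y + 1) = g y.

Definition T0 (x : R) : R := frac (2 * x).

Definition varphi (x : R) : R := \1_(`[1 / 2, 1]%classic : set R) x.

Definition skew_rotation (t : R) (z : R * R) : R * R :=
  (T0 z.1, frac (z.2 + t * varphi z.1)).

Definition F0 : R * R -> R * R := skew_rotation (theta R).

Definition D_pert (j : nat) (g : R -> R) (y : R) : R :=
  frac (y + delta R j * g y).

(* D_pert j g commutes with integer translations when g is 1-periodic, so it
   is well defined on the circle. *)
Definition F_pert (j : nat) (g : R -> R) (z : R * R) : R * R :=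
  let w := skew_rotation (theta_ R j) z in (w.1, D_pert j g w.2).

Definition smooth (g : R -> R) : Prop :=
  forall (n : nat) (y : R), derivable (derive1n n g) y 1.

(* The interval on which the derivative is positive is taken open: by
   continuity the derivative vanishes at its end points, since it is negative
   on the other side. *)
Definition admissible (j : nat) (g : R -> R) : Prop :=
  let k : R := (period j)%:R in
  let y := orbit_pt R j in
  [/\ periodic1 g, smooth g, (forall t, `|g t| <= 1) &
    forall i, (i < period j)%N ->
      [/\ g (y i) = 0 /\ g (y i + 1 / (2 * k)) = 0,
        (forall t, y i < t < y i + 1 / (2 * k) -> g t < 0),
        (forall t, y i + 1 / (2 * k) < t < y i.+1 -> 0 < g t),
        (forall t, y i + 1 / (3 * k) < t < y i.+1 - 1 / (3 * k) ->
           0 < derive1 g t) &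
        (forall t, y i <= t < y i + 1 / (3 * k) \/
                   y i.+1 - 1 / (3 * k) < t <= y i.+1 ->
           derive1 g t < 0)]].

End Maps.

(* R and R x R with their Borel sigma-algebras, in the form in which
   lebesgue_measure carries them. *)
Notation line R := (measurableTypeR R).
Notation plane R := (measurableTypeR R * measurableTypeR R)%type.

Section Measures.
Context (R : realType).

Definition cylinder : set (plane R) := `[0, 1]%classic `*` `[0, 1[%classic.

Definition concentrated d (T : measurableType d) (A : set T)
    (m : set T -> \bar R) : Prop :=
  forall E, measurable E -> m E = m (E `&` A).

(* The norm of the signed measure a - b on the circle.  A 1-periodic function
   is 1-Lipschitz for the distance of R/Z iff it is 1-Lipschitz on R. *)
Definition W1_norm (a b : {measure set line R -> \bar R}) : \bar R :=
  ereal_sup [set (`| \int[a]_y h y - \int[b]_y h y |)%:E | h in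
    [set h : R -> R | [/\ periodic1 h, 1.-lipschitz h &
                          forall y, `|h y| <= 1]]].

Definition snd_image (m : {measure set plane R -> \bar R}) :
    set (line R) -> \bar R :=
  pushforward m snd.

HB.instance Definition _ (m : {measure set plane R -> \bar R}) :=
  Measure.copy (snd_image m)
    (measure_function_pushforward__canonical__measure_function_Measure m
       (measurable_snd : measurable_fun [set: plane R] snd)).

Definition is_marginal_density (m : {measure set plane R -> \bar R})
    (phi : R -> {nonneg R}) : Prop :=
  measurable_fun [set: line R] (fun s => (phi s)%:num) /\
  forall A : set (line R), measurable A ->
    pushforward m fst A = (\int[lebesgue_measure]_(s in A) (phi s)%:num%:E)%E.

(* k s is a probability measure on the leaf {s} x R/Z; the values of k outside
   [0,1] are irrelevant. *)
Definition is_disintegration (m : {measure set plane R -> \bar R})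
    (k : R.-pker line R ~> plane R) : Prop :=
  (forall s, 0 <= s <= 1 -> k s ([set s] `*` `[0, 1[%classic) = 1%E) /\
  forall E : set (plane R), measurable E ->
    m E = (\int[pushforward m fst]_(s in `[0%R, 1%R]) k s E)%E.

Definition leaf_measure (phi : R -> {nonneg R}) (k : R.-pker line R ~> plane R)
    (s : R) : {measure set line R -> \bar R} :=
  mscale (phi s) (snd_image (k s)).

(* The densities and the disintegrations are almost everywhere unique, and the
   Jordan decomposition is unique, so it does not matter which ones are
   chosen.  leaf_measure phi k s is the measure usually written nu|_s. *)
Definition in_L1 (nu : {charge set plane R -> \bar R}) : Prop :=
  concentrated cylinder nu /\
  exists (P N : set (plane R)) (nuPN : hahn_decomposition nu P N),
    [/\ pushforward (jordan_pos nuPN) fst `<< @lebesgue_measure R,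
        pushforward (jordan_neg nuPN) fst `<< @lebesgue_measure R &
        exists (phip phin : R -> {nonneg R}) (kp kn : R.-pker line R ~> plane R),
          [/\ is_marginal_density (jordan_pos nuPN) phip,
              is_marginal_density (jordan_neg nuPN) phin,
              is_disintegration (jordan_pos nuPN) kp,
              is_disintegration (jordan_neg nuPN) kn &
              (\int[lebesgue_measure]_(s in `[0%R, 1%R])
                 W1_norm (leaf_measure phip kp s) (leaf_measure phin kn s)
               < +oo)%E]].

Definition invariant_measure (F : R * R -> R * R)
    (m : set (plane R) -> \bar R) : Prop :=
  forall E : set (plane R), measurable E -> pushforward m F E = m E.

Definition lebesgue2 : {measure set plane R -> \bar R} :=
  (@lebesgue_measure R \x @lebesgue_measure R)%E.

Definition square_integrable_on (D : set (plane R)) (f : plane R -> R) : Prop :=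
  measurable_fun D f /\
  (\int[lebesgue2]_(z in D) ((f z) ^+ 2)%:E < +oo)%E.

(* The derivative is the pointwise one, not just a weak one: functions defined
   only almost everywhere cannot be integrated against the invariant measures,
   which may be singular.  Continuity on the boundary x = 0, 1 is required
   separately, since differentiability only concerns the interior. *)
Definition observable_L2_derivative (psi : R * R -> R) : Prop :=
  [/\ forall x y, psi (x, y + 1) = psi (x, y),
      {within `[0, 1]%classic `*` [set: R], continuous psi},
      forall z : R * R, 0 < z.1 < 1 -> differentiable psi z,
      square_integrable_on (`]0, 1[%classic `*` `[0, 1[%classic)
        ('D_(1, 0) psi) &
      square_integrable_on (`]0, 1[%classic `*` `[0, 1[%classic)
        ('D_(0, 1) psi)].

End Measures.

(* Main.v *)
Require Import Defs.
From mathcomp Require Import all_boot all_order all_algebra.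
From mathcomp Require Import all_classical all_reals all_analysis.
From mathcomp Require Import measurable_realfun ring lra zify.
Import Order.TTheory GRing.Theory Num.Theory.
Import numFieldNormedType.Exports.
Local Open Scope classical_set_scope.
Local Open Scope ring_scope.

(* Write k_i for the period and d_i for delta_i, so that 1 <= k_i^4 d_i <= 2, and
   put w_i = 4 pi k_i.  The observable is psi = sum_(i >= 1) psi_i with
     psi_i (x, y) = k_i (sin (w_i (y + 2 d_i x)) - sin (w_i (y + d_i x))),
   whose gradient is of order 1 / k_i.  With u_i (x, y) = sin (w_i (y + d_i x)),
   the term psi_i is the coboundary k_i (u_i o F_0 - u_i), because T_0 x = 2 x - phi x
   and w_i theta_i is a multiple of 2 pi.  Since the j-th perturbed map is
   2 d_j-close to F_0, the integral of psi_i against mu_j is O (k_i^2 d_j) for every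
   i; for i < j this is much smaller than k_j^2 d_j.  The terms i > j
   contribute O (k_j^-8), and all terms have mean zero for Lebesgue measure.

   There remains psi_j, of frequency 2 k_j in y.  The function
   min (cos (2 pi k_j y), cos (2 pi k_j d_j)) does not decrease along orbits, so
   mu_j lives where it is invariant: within d_j of the attracting orbit
   (1 / k_j) Z, or on the repelling orbit 1 / (2 k_j) + (1 / k_j) Z.  At both places
   cos (w_j y) is close to 1, hence psi_j is at least c k_j^2 d_j x there.
   Finally the mean of x is bounded below since cos (2 pi x) has mean zero for mu_j:
   its mean equals that of cos (2 pi 2^n x) for all n, and the Cesaro averages of
   these orthogonal functions tend to 0 in Lebesgue measure, hence also in measure
   for the absolutely continuous marginal.  So the total is at least
   c' k_j^2 d_j >= c' sqrt d_j. *)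

(** * Series dominated by a geometric series *)

Section GeometricTail.
Context {R : realType}.
Implicit Types (a : nat -> R) (C : R).

Lemma geometric_partial_sum m n : (m <= n)%N ->
  \sum_(m <= i < n) (2 : R) ^- i = 2 * (2 ^- m - 2 ^- n).
Proof.
move=> /subnK <-; elim: (n - m)%N => [|p IH].
  by rewrite add0n big_geq// subrr mulr0.
rewrite addSn big_nat_recr ?leq_addl//= IH exprS invfM; field.
by rewrite !expf_neq0.
Qed.

Lemma norm_partial_sum_le_geometric a C m n : 0 <= C ->
  (forall i, (m <= i)%N -> `|a i| <= C * 2 ^- i) ->
  `|\sum_(m <= i < n) a i| <= 2 * C * 2 ^- m.
Proof.
move=> C0 aC.
have [mn|nm] := leqP m n; last first.
  by rewrite big_geq 1?ltnW// normr0 mulr_ge0 ?mulr_ge0//.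
apply: le_trans (ler_norm_sum _ _ _) _.
apply: (@le_trans _ _ (\sum_(m <= i < n) C * 2 ^- i)).
  by apply: ler_sum_nat => i /andP[mi _]; exact: aC.
rewrite -mulr_sumr geometric_partial_sum// mulrA (mulrC C) ler_wpM2l ?mulr_ge0//.
by rewrite lerBlDr lerDl invr_ge0 exprn_ge0.
Qed.

Lemma is_cvg_series_geometric a C m : 0 <= C ->
  (forall i, (m <= i)%N -> `|a i| <= C * 2 ^- i) ->
  cvgn (fun n => \sum_(m <= i < n) a i).
Proof.
move=> C0 aC.
(* [series] always starts at index 0, so the terms below m are replaced by 0. *)
pose b i := if (m <= i)%N then a i else 0.
have -> : (fun n => \sum_(m <= i < n) a i) = series b.
  apply/funext => n; rewrite /series /=.
  rewrite -big_mkcond /=.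
  have [mn|nm] := leqP m n; last first.
    rewrite [LHS]big_geq 1?ltnW// [RHS]big1_seq// => i.
    by rewrite mem_index_iota => /and3P[mi _ ni]; lia.
  rewrite (@big_cat_nat _ _ _ m 0 n)//= [X in _ = X + _]big1_seq ?add0r.
    rewrite [RHS]big_nat_cond [LHS]big_nat_cond; apply: eq_bigl => i.
    by apply/idP/idP; lia.
  by move=> i; rewrite mem_index_iota => /and3P[mi _ ni]; lia.
apply: normed_cvg.
apply: (@series_le_cvg _ _ (geometric C 2^-1)).
- by move=> n; rewrite normr_ge0.
- by move=> n; rewrite /geometric/= mulr_ge0// exprn_ge0// invr_ge0.
- move=> n; rewrite /geometric /= /b; case: ifPn => [mn|_].
    by rewrite exprVn; exact: aC.
  by rewrite normr0 mulr_ge0// exprn_ge0// invr_ge0.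
- apply: is_cvg_geometric_series.
  by rewrite ger0_norm ?invr_ge0// invf_lt1// ltr1n.
Qed.

Lemma norm_series_le_geometric a C m : 0 <= C ->
  (forall i, (m <= i)%N -> `|a i| <= C * 2 ^- i) ->
  `|limn (fun n => \sum_(m <= i < n) a i)| <= 2 * C * 2 ^- m.
Proof.
move=> C0 aC.
have cv := is_cvg_series_geometric _ _ _ C0 aC.
rewrite -lim_norm//; apply: limr_le; first exact: is_cvg_norm.
by apply: nearW => n; exact: norm_partial_sum_le_geometric.
Qed.

Lemma limn_series_split a m n : (m <= n)%N ->
  cvgn (fun p => \sum_(n <= i < p) a i) ->
  limn (fun p => \sum_(m <= i < p) a i) =
  \sum_(m <= i < n) a i + limn (fun p => \sum_(n <= i < p) a i).
Proof.
move=> mn cv; apply/cvg_lim => //.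
apply: (@cvg_trans _ ((fun p => \sum_(m <= i < n) a i + \sum_(n <= i < p) a i) @ \oo)).
  apply: near_eq_cvg; near=> p.
  by rewrite -big_cat_nat//; near: p; exact: nbhs_infty_ge.
by apply: cvgD => //; exact: cvg_cst.
Unshelve. all: by end_near. Qed.

End GeometricTail.

(** * Arithmetic of the periods k_i and of the angles theta_i and d_i *)

Section Angles.
Context (R : realType).
Local Notation k := (fun i => (period i)%:R : R).

Lemma theta_termE i : theta_term R i = (k i)^-1.
Proof. by rewrite /theta_term /period natrX. Qed.

Lemma periodS i : period i.+1 = (period i ^ 4)%N.
Proof. by rewrite /period -expnM mulnS expnD mulnC. Qed.

Lemma period_ge16 i : (1 <= i)%N -> (16 <= period i)%N.
Proof.
case: i => // i _; rewrite periodS (_ : 16 = 2 ^ 4)%N// leq_exp2r//.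
rewrite /period.
by apply: (@leq_pexp2l 2 1); rewrite ?expn_gt0.
Qed.

Lemma period_gt0 i : (0 < period i)%N.
Proof. by rewrite /period expn_gt0. Qed.

(** From k_(i+1) = k_i^4 only k_(i+1) >= 2 k_i is kept: ratio 2 is enough to bound the tails of the
    series of 1 / k_i by twice their first term. *)
Lemma period_geometric m i : (m <= i)%N -> (period m * 2 ^ (i - m) <= period i)%N.
Proof.
move=> /subnK <-; elim: (i - m)%N => [|p IH]; first by rewrite add0n subnn muln1.
rewrite addSn periodS subSn ?leq_addl//.
have := IH; set q := (p + m)%N; move=> {}IH.
have q2 : (2 <= period q)%N.
  by rewrite /period; apply: (@leq_pexp2l 2 1); rewrite ?expn_gt0.
rewrite expnS mulnCA; apply: (leq_trans (n := period q * period q)).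
  by apply: leq_mul.
rewrite (_ : 4 = 2 + 2)%N// expnD -!mulnn.
by apply: leq_pmulr; rewrite !muln_gt0 period_gt0.
Qed.

Lemma period_dvd i j : (i <= j)%N -> (period i %| period j)%N.
Proof.
move=> ij; rewrite /period dvdn_exp2l// leq_exp2l// leq_mul2l ij orbT//.
Qed.

Lemma period_inv_le m i : (m <= i)%N ->
  (k i)^-1 <= (k m)^-1 * 2 ^+ m * 2 ^- i.
Proof.
move=> mi; have := period_geometric _ _ mi.
have k0 n : 0 < k n by rewrite ltr0n period_gt0.
rewrite -(ler_nat R) natrM natrX => H.
rewrite -[leRHS]invrK lef_pV2 ?posrE ?invr_gt0 ?mulr_gt0 ?invr_gt0 ?exprn_gt0//.
rewrite !invfM !invrK; apply: le_trans H.
rewrite -{1}(subnK mi) exprD.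
by rewrite mulrACA mulVf ?mulr1 ?expf_neq0.
Qed.

Lemma theta_term_norm m i : (m <= i)%N ->
  `|theta_term R i| <= (k m)^-1 * 2 ^+ m * 2 ^- i.
Proof.
by move=> mi; rewrite theta_termE ger0_norm ?invr_ge0//; exact: period_inv_le.
Qed.

Let C0 m : 0 <= (k m)^-1 * 2 ^+ m.
Proof. by rewrite mulr_ge0 ?invr_ge0 ?exprn_ge0. Qed.

Lemma delta_recl j : delta R j = theta_term R j.+1 + delta R j.+1.
Proof.
rewrite /delta (limn_series_split _ _ j.+2)// ?big_nat1//.
exact: (is_cvg_series_geometric _ _ _ (C0 j.+2) (theta_term_norm _)).
Qed.

Lemma delta_le j : delta R j <= 2 / k j.+1.
Proof.
apply: le_trans (ler_norm _) _.
apply: le_trans (norm_series_le_geometric _ _ _ (C0 j.+1) (theta_term_norm _)) _.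
by rewrite -!mulrA mulfV ?mulr1// expf_neq0.
Qed.

Lemma delta_ge0 j : 0 <= delta R j.
Proof.
apply: limr_ge.
  exact: (is_cvg_series_geometric _ _ _ (C0 j.+1) (theta_term_norm _)).
by apply: nearW => n; apply: sumr_ge0 => i _; rewrite theta_termE invr_ge0.
Qed.

Lemma delta_ge j : (k j.+1)^-1 <= delta R j.
Proof. by rewrite delta_recl theta_termE lerDl delta_ge0. Qed.

Lemma delta_gt0 j : 0 < delta R j.
Proof. by rewrite (lt_le_trans _ (delta_ge j))// invr_gt0 ltr0n period_gt0. Qed.

Lemma theta_addS j : theta_ R j.+1 = theta_ R j + theta_term R j.+1.
Proof. by rewrite /theta_ big_nat_recr. Qed.

(** Both sides are the full series: raising the index moves one term from the tail to the partial
    sum. *)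
Lemma theta_delta i j : theta_ R j + delta R j = theta_ R i + delta R i.
Proof.
suff H n : theta_ R n + delta R n = theta_ R 0 + delta R 0 by rewrite !H.
by elim: n => // n <-; rewrite [in RHS]delta_recl theta_addS addrA.
Qed.

(** Every k_i with i <= j divides k_j, so k_j clears all denominators of the partial sum. *)
Lemma period_theta_nat j : exists n : nat, k j * theta_ R j = n%:R.
Proof.
exists (\sum_(1 <= i < j.+1) period j %/ period i)%N.
rewrite /theta_ mulr_sumr natr_sum; apply: eq_big_nat => i /andP[_ ij].
rewrite theta_termE natf_div ?period_dvd//.
Qed.

Lemma period_delta_bounds j : 1 <= k j ^+ 4 * delta R j <= 2.
Proof.
have k0 : 0 < k j by rewrite ltr0n period_gt0.
have := delta_ge j; have := delta_le j; rewrite periodS natrX => h1 h2.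
apply/andP; split.
  by rewrite mulrC -ler_pdivrMr ?exprn_gt0// mul1r.
by rewrite mulrC -ler_pdivlMr ?exprn_gt0.
Qed.

End Angles.

(** * Elementary bounds for sine and cosine *)

Section Trigonometry.
Context {R : realType}.
Implicit Types u v h x : R.

Lemma sin_lipschitz u v : `|sin u - sin v| <= `|u - v|.
Proof.
wlog vu : u v / v <= u.
  by move=> H; have [|/ltW] := leP v u; [|rewrite distrC (distrC u)]; exact: H.
have [c _ ->] := @MVT_segment R sin cos v u vu
  (fun x _ => is_derive_sin x) (continuous_subspaceT (@continuous_sin R)).
by rewrite normrM ler_piMl// cos_max.
Qed.

Lemma cos_lipschitz u v : `|cos u - cos v| <= `|u - v|.
Proof.
rewrite -!sinDpihalf (le_trans (sin_lipschitz _ _))//.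
by rewrite opprD addrACA subrr addr0.
Qed.

Lemma norm_sin_le u : `|sin u| <= `|u|.
Proof. by have := sin_lipschitz u 0; rewrite sin0 !subr0. Qed.

Lemma cos_ge_quadratic u : 1 - u ^+ 2 / 2 <= cos u.
Proof.
rewrite (_ : u = (u / 2) *+ 2); last by rewrite -mulr_natr divfK.
rewrite cos_mulr2n cos2sin2.
have : sin (u / 2) ^+ 2 <= (u / 2) ^+ 2.
  by rewrite -ler_sqrt ?sqr_ge0// !sqrtr_sqr norm_sin_le.
by lra.
Qed.

(** By the mean value theorem sin u = u cos c with 0 <= c <= 1, and cos c >= 1 - c^2 / 2 >= 1 /
    2. *)
Lemma sin_ge_half u : 0 <= u <= 1 -> u / 2 <= sin u.
Proof.
move=> /andP[u0 u1].
have [c cu ->] : exists2 c, c \in `[0, u]%R & sin u = cos c * u.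
  have [c cu] := @MVT_segment R sin cos 0 u u0
    (fun x _ => is_derive_sin x) (continuous_subspaceT (@continuous_sin R)).
  by rewrite sin0 !subr0 => H; exists c.
move: cu; rewrite in_itv/= => /andP[c0 cu].
rewrite mulrC ler_wpM2r//; apply: le_trans (cos_ge_quadratic c).
have : c ^+ 2 <= 1 by rewrite expr_le1// (le_trans cu).
lra.
Qed.

(** The mean value theorem gives sin (u + h) - sin u = h cos c with |c - u| <= |h|, and cosine is
    1-Lipschitz. *)
Lemma sin_taylor1 u h : `|sin (u + h) - sin u - h * cos u| <= h ^+ 2.
Proof.
have [c ch ->] : exists2 c, `|c - u| <= `|h| & sin (u + h) - sin u = cos c * h.
  have [h0|h0] := leP 0 h.
    have [|c] := @MVT_segment R sin cos u (u + h) _ (fun x _ => is_derive_sin x)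
      (continuous_subspaceT (@continuous_sin R)); first by rewrite lerDl.
    rewrite in_itv/= => /andP[uc cuh] H; exists c.
      by rewrite (ger0_norm h0) ger0_norm ?subr_ge0// lerBlDl.
    by rewrite H addrAC subrr add0r.
  have [|c] := @MVT_segment R sin cos (u + h) u _ (fun x _ => is_derive_sin x)
    (continuous_subspaceT (@continuous_sin R)); first by rewrite gerDl ltW.
  rewrite in_itv/= => /andP[uc cuh] H; exists c.
    by rewrite distrC (ltr0_norm h0) ger0_norm ?subr_ge0//; lra.
  by rewrite -opprB H opprD addrA subrr sub0r mulrN opprK.
rewrite mulrC -mulrBr normrM -(real_normK (num_real h)) expr2 ler_wpM2l//.
exact: le_trans (cos_lipschitz _ _) ch.
Qed.

Lemma cosD2pin u (n : nat) : cos (u + pi *+ 2 *+ n) = cos u.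
Proof. by rewrite periodicn//; exact: cosD2pi. Qed.

Lemma cosD2piz u (n : int) : cos (u + 2 * pi * n%:~R) = cos u.
Proof.
rewrite mulr_natl; case: n => n.
  by rewrite -pmulrn mulr_natr cosD2pin.
rewrite NegzE -[in RHS](subrK (pi *+ 2 *+ n.+1) u) cosD2pin.
by rewrite mulrNz mulrN -pmulrn mulr_natr.
Qed.

Lemma sinD2piz u (n : int) : sin (u + 2 * pi * n%:~R) = sin u.
Proof. by rewrite -!cosBpihalf addrAC cosD2piz. Qed.

Lemma pi_le4 : pi <= 4 :> R.
Proof. by have := @pihalf_lt2 R; lra. Qed.

End Trigonometry.

(** * Differentiating a series of functions on the plane term by term *)

Section TermwiseDifferentiation.
Context {R : realType}.

Lemma differentiable_of_remainder (V W : normedModType R) (f : V -> W)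
    (df : {linear V -> W}) (z : V) : continuous df ->
  (forall e : R, 0 < e -> exists2 r, 0 < r & forall h : V, `|h| < r ->
     `|f (z + h) - f z - df h| <= e * `|h|) ->
  differentiable f z /\ 'd f z = df :> (V -> W).
Proof.
move=> cdf H.
have fo : f \o shift z = cst (f z) + df +o_ 0 id.
  apply/eqaddoP => _/posnumP[e]; have [r r0 rP] := H e%:num [gt0 of e%:num].
  apply/nbhs_ballP; exists r => // h; rewrite -ball_normE/= sub0r normrN => hr.
  by have := rP h hr; rewrite !fctE/= opprD addrA (addrC h).
have dE : 'd f z = df :> (V -> W) by exact: diff_unique.
by split => //; apply/diff_locallyP; rewrite dE.
Qed.

Local Notation V := (R * R)%type.

Lemma differentiable_plane (f : V -> R) (z : V) (a b : R) :
  (forall e, 0 < e -> exists2 r, 0 < r & forall h : V, `|h| < r ->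
     `|f (z + h) - f z - (a * h.1 + b * h.2)| <= e * `|h|) ->
  [/\ differentiable f z, 'D_(1, 0) f z = a & 'D_(0, 1) f z = b].
Proof.
move=> H.
pose df : {linear V -> R} := (a \*: (@fst R R : {linear V -> R})) \+
  (b \*: (@snd R R : {linear V -> R})).
have dfE h : df h = a * h.1 + b * h.2 by [].
have cdf : continuous df.
  move=> x; apply: cvgD; apply: cvgM; first exact: cvg_cst.
  - exact: cvg_fst.
  - exact: cvg_cst.
  - exact: cvg_snd.
have [df0 dE] := differentiable_of_remainder _ _ _ _ _ cdf H.
by split => //; rewrite deriveE// dE dfE /=; ring.
Qed.

Variables (f : nat -> V -> R) (p q : nat -> R) (z : V) (M : R) (C : nat -> R).
Hypothesis M0 : 0 <= M.
Hypothesis C0 : forall i, 0 <= C i.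
Hypothesis cvgf : forall z, cvgn (fun n => \sum_(1 <= i < n) f i z).
Hypothesis pM : forall i, (1 <= i)%N -> `|p i| <= M * 2 ^- i.
Hypothesis qM : forall i, (1 <= i)%N -> `|q i| <= M * 2 ^- i.
Hypothesis fM : forall i h, (1 <= i)%N -> `|h| <= 1 ->
  `|f i (z + h) - f i z| <= M * 2 ^- i * `|h|.
Hypothesis fC : forall i h, (1 <= i)%N ->
  `|f i (z + h) - f i z - (p i * h.1 + q i * h.2)| <= C i * `|h| ^+ 2.

(** The quadratic constants [C i] may grow with i, so they serve only for a finite head of the
    series. The tail of the first-order remainders is controlled by the Lipschitz bounds and the
    bounds on p and q, which are geometric in i. *)
Lemma termwise_differentiable :
  let F z := limn (fun n => \sum_(1 <= i < n) f i z) in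
  [/\ differentiable F z,
      'D_(1, 0) F z = limn (fun n => \sum_(1 <= i < n) p i) &
      'D_(0, 1) F z = limn (fun n => \sum_(1 <= i < n) q i)].
Proof.
move=> F.
have cp := is_cvg_series_geometric _ _ _ M0 pM.
have cq := is_cvg_series_geometric _ _ _ M0 qM.
apply: differentiable_plane => e e0.
(* Each remainder is at most 3 M 2^-i |h|, one M for the increment and one for each of p and q; from
   this n on they add up to at most e / 2 |h|. *)
have [n nP] : exists n, 2 * (3 * M) * 2 ^- n <= e / 2 /\ (1 <= n)%N.
  have /cvgrPdist_le/(_ _ (divr_gt0 e0 (@ltr0Sn R 1))) : 
      (fun n => 2 * (3 * M) * 2 ^- n) @ \oo --> (0 : R).
    rewrite -(mulr0 (2 * (3 * M))); apply: cvgM; first exact: cvg_cst.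
    under eq_fun do rewrite -exprVn.
    by apply: cvg_expr; rewrite ger0_norm ?invr_ge0// invf_lt1// ltr1n.
  move=> [n _ nP]; exists n.+1; split => //.
  have := nP n.+1 (leqnSn n); rewrite sub0r normrN ger0_norm//.
  by rewrite !mulr_ge0// invr_ge0 exprn_ge0.
move: nP => [nP n1].
pose K := \sum_(1 <= i < n) C i.
have K0 : 0 <= K by exact: sumr_ge0.
(* Within this radius the head contributes at most K |h|^2 <= e / 2 |h|; K + 1 avoids a division by
   zero. *)
exists (Num.min 1 (e / (2 * (K + 1)))).
  by rewrite lt_min ltr01/= divr_gt0// mulr_gt0// ltr_wpDl.
move=> h; rewrite lt_min => /andP[h1 hK].
pose r i := f i (z + h) - f i z - (p i * h.1 + q i * h.2).
have [hx hy] : `|h.1| <= `|h| /\ `|h.2| <= `|h|.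
  by rewrite prod_normE; split; rewrite le_max lexx ?orbT.
have rM i : (1 <= i)%N -> `|r i| <= (3 * M * `|h|) * 2 ^- i.
  move=> i1; rewrite /r; apply: le_trans (ler_normB _ _) _.
  have H1 := fM i h i1 (ltW h1).
  have H2 : `|p i * h.1| <= M * 2 ^- i * `|h| by rewrite normrM ler_pM// pM.
  have H3 : `|q i * h.2| <= M * 2 ^- i * `|h| by rewrite normrM ler_pM// qM.
  have H4 := ler_normD (p i * h.1) (q i * h.2).
  have -> : 3 * M * `|h| * 2 ^- i = 3 * (M * 2 ^- i * `|h|) by ring.
  lra.
have -> : F (z + h) - F z - (limn (fun n => \sum_(1 <= i < n) p i) * h.1 +
    limn (fun n => \sum_(1 <= i < n) q i) * h.2) =
    limn (fun n => \sum_(1 <= i < n) r i).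
  apply/esym/cvg_lim => //.
  rewrite (_ : (fun n => _) = (fun n => \sum_(1 <= i < n) f i (z + h) - 
    \sum_(1 <= i < n) f i z -
    ((\sum_(1 <= i < n) p i) * h.1 + (\sum_(1 <= i < n) q i) * h.2))).
    apply: cvgB; first by apply: cvgB; exact: cvgf.
    apply: cvgD; apply: cvgM; [exact: cp|exact: cvg_cst|exact: cq|exact: cvg_cst].
  apply/funext => m; rewrite !mulr_suml -big_split/= -!sumrB.
  by [].
have A0 : 0 <= 3 * M * `|h| by rewrite !mulr_ge0.
have rM' i : (n <= i)%N -> `|r i| <= (3 * M * `|h|) * 2 ^- i.
  by move=> ni; apply: rM; exact: leq_trans ni.
rewrite (limn_series_split _ _ n)//; last exact: (is_cvg_series_geometric _ _ _ A0 rM').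
apply: le_trans (ler_normD _ _) _.
have T2 := norm_series_le_geometric _ _ _ A0 rM'.
have T1 : `|\sum_(1 <= i < n) r i| <= K * `|h| ^+ 2.
  apply: le_trans (ler_norm_sum _ _ _) _.
  rewrite mulr_suml; apply: ler_sum_nat => i /andP[i1 _]; exact: fC.
have T3 : K * `|h| ^+ 2 <= e / 2 * `|h|.
  rewrite expr2 mulrA ler_wpM2r//.
  move: hK; rewrite ltr_pdivlMr; last by rewrite mulr_gt0// ltr_wpDl.
  have := normr_ge0 h; lra.
have T4 : 2 * (3 * M * `|h|) / 2 ^+ n <= e / 2 * `|h|.
  by rewrite [leLHS](_ : _ = 2 * (3 * M) * 2 ^- n * `|h|) ?ler_wpM2r//; ring.
lra.
Qed.

End TermwiseDifferentiation.

(** * The observable and its derivatives *)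

Section Observable.
Context (R : realType).
Local Notation k i := ((period i)%:R : R).
Local Notation V := (R * R)%type.

(** Twice the frequency of the orbit of period k_i: cos ([freq i] * y) equals 1 at the multiples of
    1 / k_i and also at the midpoints between them. *)
Definition freq (i : nat) : R := 4 * pi * k i.

Definition obs_term (i : nat) (z : V) : R :=
  k i * (sin (freq i * (z.2 + 2 * delta R i * z.1)) -
         sin (freq i * (z.2 + delta R i * z.1))).

Definition obs (z : V) : R := limn (fun n => \sum_(1 <= i < n) obs_term i z).

Lemma natr_period_gt0 i : 0 < k i. Proof. by rewrite ltr0n period_gt0. Qed.

Lemma natr_period_ge16 i : (1 <= i)%N -> 16 <= k i.
Proof. by move=> i1; rewrite ler_nat period_ge16. Qed.

Lemma freq_ge0 i : 0 <= freq i.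
Proof. by rewrite /freq !mulr_ge0// pi_ge0. Qed.

Lemma freq_le i : freq i <= 16 * k i.
Proof. by rewrite /freq ler_wpM2r//; have := @pi_le4 R; lra. Qed.

(** The product form separates a small sine factor, independent of y, from a bounded oscillation in
    y. It gives the size of the term, its zero mean for Lebesgue measure and its sign near the
    attracting and repelling orbits. *)
Lemma obs_termE i (z : V) : obs_term i z =
  2 * k i * (cos (freq i * (z.2 + 3 / 2 * delta R i * z.1)) *
             sin (freq i * delta R i * z.1 / 2)).
Proof.
rewrite /obs_term; set w := freq i; set d := delta R i.
have -> : w * (z.2 + 2 * d * z.1) =
   w * (z.2 + 3 / 2 * d * z.1) + w * d * z.1 / 2 by field.
have -> : w * (z.2 + d * z.1) =
   w * (z.2 + 3 / 2 * d * z.1) - w * d * z.1 / 2 by field.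
by rewrite sinD sinB; ring.
Qed.

Lemma obs_term_periodic i x y : obs_term i (x, y + 1) = obs_term i (x, y).
Proof.
rewrite /obs_term /=; set d := delta R i.
have P c : freq i * (y + 1 + c) =
    freq i * (y + c) + 2 * pi * (2 * (period i))%:Z%:~R.
  by rewrite /freq -pmulrn natrM; ring.
by rewrite !P !sinD2piz.
Qed.

(** Up to a constant, k_i^3 d_i is the size of the y-derivative of [obs_term i] for bounded x: one
    k_i is the amplitude, one comes from differentiating, and k_i d_i is the phase shift between the
    two sines. As d_i is of order k_i^-4, this is of order 1 / k_i, hence summable. *)
Lemma k3delta_le i : k i ^+ 3 * delta R i <= 2 / k i.
Proof.
rewrite ler_pdivlMr ?natr_period_gt0//.
have /andP[_] := period_delta_bounds R i.
by apply: le_trans; rewrite mulrAC -exprSr.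
Qed.

Lemma k_inv_le i : (k i)^-1 <= 2 ^- i.
Proof.
have := period_inv_le R 0 i isT; rewrite expr0 mulr1 => /le_trans; apply.
rewrite ler_piMl ?invr_ge0 ?exprn_ge0// invf_le1 ?natr_period_gt0//.
by rewrite ler1n period_gt0.
Qed.

Lemma k3delta_le_geometric i : k i ^+ 3 * delta R i <= 2 * 2 ^- i.
Proof. by apply: le_trans (k3delta_le i) _; rewrite ler_wpM2l// k_inv_le. Qed.

Lemma obs_term_bound i z : `|obs_term i z| <= 16 * k i ^+ 2 * delta R i * `|z.1|.
Proof.
rewrite obs_termE; move: (freq_ge0 i) (freq_le i); move: (freq i) => w w0 wk.
rewrite !normrM.
apply: (@le_trans _ _ (2 * k i * (1 * `|w * delta R i * z.1 / 2|))).
  by rewrite ger0_norm// (@ger0_norm _ (k i))// ler_wpM2l// ler_pM// ?cos_max// norm_sin_le.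
rewrite !normrM (ger0_norm w0) (ger0_norm (delta_ge0 _ _)) mul1r.
rewrite (@ger0_norm _ 2^-1)//.
have -> : 2 * k i * (w * delta R i * `|z.1| / 2) =
   w * (k i * delta R i * `|z.1|) by field.
have -> : 16 * k i ^+ 2 * delta R i * `|z.1| =
   16 * k i * (k i * delta R i * `|z.1|) by ring.
by rewrite ler_wpM2r ?wk// !mulr_ge0// delta_ge0.
Qed.

Lemma k2delta_le_geometric i : k i ^+ 2 * delta R i <= 2 * 2 ^- i.
Proof.
apply: le_trans (k3delta_le_geometric i).
rewrite ler_wpM2r ?delta_ge0// ler_weXn2l//.
by rewrite ler1n period_gt0.
Qed.

Lemma obs_term_geometric i z : `|obs_term i z| <= 32 * `|z.1| * 2 ^- i.
Proof.
apply: le_trans (obs_term_bound i z) _.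
have -> : 32 * `|z.1| * 2 ^- i = 16 * `|z.1| * (2 * 2 ^- i) by ring.
have -> : 16 * k i ^+ 2 * delta R i * `|z.1| = 16 * `|z.1| * (k i ^+ 2 * delta R i) by ring.
by rewrite ler_wpM2l ?mulr_ge0// k2delta_le_geometric.
Qed.

Lemma cvg_obs z m : cvgn (fun n => \sum_(m <= i < n) obs_term i z).
Proof.
apply: (@is_cvg_series_geometric _ _ (32 * `|z.1|)).
  by rewrite mulr_ge0.
by move=> i _; exact: obs_term_geometric.
Qed.

Lemma obs_periodic x y : obs (x, y + 1) = obs (x, y).
Proof.
rewrite /obs; congr (lim (_ @ \oo)); apply/funext => n.
by apply: eq_bigr => i _; exact: obs_term_periodic.
Qed.

(** The x-derivative of [obs_term i]; [obs_py] is the y-derivative. *)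
Definition obs_px i (z : V) : R := k i * freq i * delta R i *
  (2 * cos (freq i * (z.2 + 2 * delta R i * z.1)) -
   cos (freq i * (z.2 + delta R i * z.1))).

Definition obs_py i (z : V) : R := k i * freq i *
  (cos (freq i * (z.2 + 2 * delta R i * z.1)) -
   cos (freq i * (z.2 + delta R i * z.1))).

Lemma obs_px_le i z : `|obs_px i z| <= 96 * 2 ^- i.
Proof.
rewrite /obs_px; move: (freq_ge0 i) (freq_le i); move: (freq i) => w w0 wk.
set a := cos _; set b := cos _.
have ab : `|2 * a - b| <= 3.
  have := cos_max (w * (z.2 + 2 * delta R i * z.1)).
  have := cos_max (w * (z.2 + delta R i * z.1)); rewrite -/a -/b !ler_norml; lra.
rewrite normrM (@ger0_norm _ (k i * _ * _)); last first.
  by rewrite !mulr_ge0// ?w0 ?delta_ge0.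
apply: (@le_trans _ _ (k i * (16 * k i) * delta R i * 3)).
  rewrite ler_pM// ?mulr_ge0 ?w0 ?delta_ge0//.
  by rewrite ler_wpM2r ?delta_ge0// ler_wpM2l// wk.
have -> : k i * (16 * k i) * delta R i * 3 = 48 * (k i ^+ 2 * delta R i) by ring.
have -> : 96 * 2 ^- i = 48 * (2 * 2 ^- i) :> R by ring.
by rewrite ler_wpM2l// k2delta_le_geometric.
Qed.

Lemma obs_py_le i z : `|obs_py i z| <= 512 * `|z.1| * 2 ^- i.
Proof.
rewrite /obs_py; move: (freq_ge0 i) (freq_le i); move: (freq i) => w w0 wk.
set a := cos _; set b := cos _.
have ab : `|a - b| <= 16 * k i * (delta R i * `|z.1|).
  apply: le_trans (cos_lipschitz _ _) _.
  have -> : w * (z.2 + 2 * delta R i * z.1) - w * (z.2 + delta R i * z.1) =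
    w * (delta R i * z.1) by ring.
  rewrite !normrM (ger0_norm w0) (ger0_norm (delta_ge0 _ _)).
  by rewrite ler_wpM2r// mulr_ge0 ?delta_ge0.
rewrite normrM (@ger0_norm _ (k i * _)); last by rewrite mulr_ge0 ?w0.
apply: (@le_trans _ _ (k i * (16 * k i) * (16 * k i * (delta R i * `|z.1|)))).
  by rewrite ler_pM// ?mulr_ge0 ?w0// ler_wpM2l// wk.
have -> : k i * (16 * k i) * (16 * k i * (delta R i * `|z.1|)) =
   256 * `|z.1| * (k i ^+ 3 * delta R i) by ring.
have -> : 512 * `|z.1| * 2 ^- i = 256 * `|z.1| * (2 * 2 ^- i) by ring.
exact: (ler_wpM2l (mulr_ge0 (ler0n R 256) (normr_ge0 z.1)) (k3delta_le_geometric i)).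
Qed.

(** In the product form the sine factor is O (k_i d_i (|x| + 1)) and the cosine factor moves by O
    (k_i |h|); with the amplitude k_i this is O (k_i^3 d_i |h|), geometric in i. *)
Lemma obs_term_lipschitz i (z h : V) : (1 <= i)%N -> `|h| <= 1 ->
  `|obs_term i (z + h) - obs_term i z| <= (2048 * (`|z.1| + 1)) * 2 ^- i * `|h|.
Proof.
move=> i1 h1; rewrite !obs_termE -mulrBr.
have [hx hy] : `|h.1| <= `|h| /\ `|h.2| <= `|h|.
  by rewrite prod_normE; split; rewrite le_max lexx ?orbT.
set d := delta R i.
move: (freq_ge0 i) (freq_le i); move: (freq i) => w w0 wk.
have d0 : 0 <= d := delta_ge0 R i.
have d1 : d <= 1.
  have := k3delta_le_geometric i; rewrite -/d => H.
  have k1 : 1 <= k i ^+ 3 by rewrite exprn_ege1// ler1n period_gt0.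
  have i2 : (2 : R) ^- i <= 2^-1.
    by rewrite lef_pV2 ?posrE ?exprn_gt0// -{1}(expr1 2) ler_weXn2l// ler1n.
  apply: (@le_trans _ _ (k i ^+ 3 * d)); first by rewrite ler_peMl.
  by apply: le_trans H _; rewrite -ler_pdivlMl// mulr1.
set P := w * ((z + h).2 + _); set P' := w * (z.2 + _).
set Q := w * d * (z + h).1 / 2; set Q' := w * d * z.1 / 2.
have HP : `|cos P - cos P'| <= w * (5 / 2 * `|h|).
  apply: le_trans (cos_lipschitz _ _) _.
  have -> : P - P' = w * (h.2 + 3 / 2 * d * h.1) by rewrite /P /P'/=; ring.
  rewrite normrM (ger0_norm w0) ler_wpM2l//.
  apply: le_trans (ler_normD _ _) _.
  have : `|3 / 2 * d * h.1| <= 3 / 2 * `|h|.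
    by rewrite normrM (@ger0_norm _ (3 / 2 * d)) ?mulr_ge0// ler_pM ?mulr_ge0// ler_piMr.
  lra.
have HQ : `|sin Q - sin Q'| <= w * d / 2 * `|h|.
  apply: le_trans (sin_lipschitz _ _) _.
  have -> : Q - Q' = w * d / 2 * h.1 by rewrite /Q /Q'/=; field.
  by rewrite normrM (@ger0_norm _ (w * d / 2)) ?mulr_ge0// ler_wpM2l// ?mulr_ge0.
have Q0 : `|sin Q| <= w * d / 2 * (`|z.1| + 1).
  apply: le_trans (norm_sin_le _) _.
  have -> : Q = w * d / 2 * (z.1 + h.1) by rewrite /Q/=; field.
  rewrite normrM (@ger0_norm _ (w * d / 2)) ?mulr_ge0// ler_wpM2l// ?mulr_ge0//.
  by rewrite (le_trans (ler_normD _ _))// lerD2l (le_trans hx).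
have -> : cos P * sin Q - cos P' * sin Q' =
  (cos P - cos P') * sin Q + cos P' * (sin Q - sin Q') by ring.
rewrite normrM (@ger0_norm _ (2 * k i)) ?mulr_ge0//.
set X := `|z.1| in Q0 *.
have X0 : 0 <= X by exact: normr_ge0.
apply: (@le_trans _ _ (2 * k i * ((16 * k i) * (5 / 2 * `|h|) * ((16 * k i) * d / 2 * (X + 1)) +
    (16 * k i) * d / 2 * `|h|))).
  have wd : w * d / 2 <= 16 * k i * d / 2.
    by rewrite !ler_wpM2r ?invr_ge0// wk.
  rewrite ler_wpM2l ?mulr_ge0//; apply: le_trans (ler_normD _ _) _.
  rewrite !normrM lerD//.
    rewrite ler_pM//.
      by apply: le_trans HP _; rewrite ler_wpM2r ?mulr_ge0 ?wk//.
    by apply: le_trans Q0 _; rewrite ler_wpM2r ?addr_ge0.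
  rewrite -[leRHS]mul1r ler_pM// ?cos_max//.
  by apply: le_trans HQ _; rewrite ler_wpM2r.
have H2 := k2delta_le_geometric i; have H3 := k3delta_le_geometric i.
rewrite -/d in H2 H3.
have -> : 2 * k i * (16 * k i * (5 / 2 * `|h|) * (16 * k i * d / 2 * (X + 1)) +
   16 * k i * d / 2 * `|h|) =
  (640 * (X + 1) * (k i ^+ 3 * d) + 16 * (k i ^+ 2 * d)) * `|h| by field.
rewrite ler_wpM2r//.
move: H2 H3; move: (k i ^+ 2 * d) (k i ^+ 3 * d) => A B H2 H3.
have e0 : (0 : R) <= 2 ^- i by rewrite invr_ge0 exprn_ge0.
move: (2 ^- i) e0 H2 H3 => e e0 H2 H3; move: X0 e0 H2 H3; clear => X0 e0 H2 H3.
have HB := ler_wpM2l (mulr_ge0 (ler0n R 640) (addr_ge0 X0 ler01)) H3.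
have HA := ler_wpM2l (ler0n R 16) H2.
have Xe := mulr_ge0 X0 e0.
have := lerD HB HA; move: Xe e0; clear; lra.
Qed.

(** Each of the two sines, of slope c = 2 d_i or c = d_i in x, is expanded to first order. The
    constant is of order k_i^3 and grows with i, as [termwise_differentiable] allows. *)
Lemma obs_term_taylor i (z h : V) :
  `|obs_term i (z + h) - obs_term i z - (obs_px i z * h.1 + obs_py i z * h.2)|
   <= 2 * k i * (freq i * (1 + 2 * delta R i)) ^+ 2 * `|h| ^+ 2.
Proof.
have [hx hy] : `|h.1| <= `|h| /\ `|h.2| <= `|h|.
  by rewrite prod_normE; split; rewrite le_max lexx ?orbT.
rewrite /obs_term /obs_px /obs_py /=.
set d := delta R i.
move: (freq_ge0 i) (freq_le i); move: (freq i) => w w0 wk.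
have d0 : 0 <= d := delta_ge0 R i.
have H c : 0 <= c <= 2 * d ->
    `|sin (w * (z.2 + h.2 + c * (z.1 + h.1))) - sin (w * (z.2 + c * z.1)) -
     (w * (h.2 + c * h.1)) * cos (w * (z.2 + c * z.1))| <=
    (w * (1 + 2 * d)) ^+ 2 * `|h| ^+ 2.
  move=> /andP[c0 cd].
  have -> : w * (z.2 + h.2 + c * (z.1 + h.1)) =
     w * (z.2 + c * z.1) + w * (h.2 + c * h.1) by ring.
  apply: le_trans (sin_taylor1 _ _) _.
  rewrite -exprMn -ler_sqrt ?sqr_ge0// !sqrtr_sqr.
  rewrite (@ger0_norm _ (w * _ * _)) ?mulr_ge0// ?addr_ge0 ?mulr_ge0//.
  rewrite normrM (ger0_norm w0) -mulrA ler_wpM2l// mulrDl mul1r.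
  rewrite (le_trans (ler_normD _ _))// lerD// normrM (ger0_norm c0).
  by rewrite ler_pM.
have k0 : 0 <= k i by [].
have H1 : 0 <= 2 * d <= 2 * d by rewrite mulr_ge0//=.
have H2 : 0 <= d <= 2 * d by rewrite d0 ler_peMl// ler1n.
move: {H} (H _ H1) (H _ H2).
set A1 := sin _; set A2 := sin _; set A3 := cos _.
set B1 := sin _; set B2 := sin _; set B3 := cos _.
set E := _ ^+ 2 * _ => HA HB.
rewrite [X in `|X|](_ : _ = k i * ((A1 - A2 - w * (h.2 + 2 * d * h.1) * A3) -
    (B1 - B2 - w * (h.2 + d * h.1) * B3))); last by ring.
rewrite normrM (ger0_norm k0) [leRHS](_ : _ = k i * (E + E)); last by rewrite /E; ring.
rewrite ler_wpM2l//.
exact: le_trans (ler_normB _ _) (lerD HA HB).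
Qed.

Lemma obs_differentiable (z : V) :
  [/\ differentiable obs z,
     'D_(1, 0) obs z = limn (fun n => \sum_(1 <= i < n) obs_px i z) &
     'D_(0, 1) obs z = limn (fun n => \sum_(1 <= i < n) obs_py i z)].
Proof.
pose M := 2048 * (`|z.1| + 1).
have z0 : 0 <= `|z.1| by [].
apply: (@termwise_differentiable _ obs_term (obs_px ^~ z) (obs_py ^~ z) z M
  (fun i => 2 * k i * (freq i * (1 + 2 * delta R i)) ^+ 2)).
- exact: (mulr_ge0 (ler0n R 2048) (addr_ge0 z0 ler01)).
- by move=> i; rewrite mulr_ge0 ?sqr_ge0// mulr_ge0.
- by move=> z'; exact: cvg_obs.
- move=> i _; apply: le_trans (obs_px_le i z) _.
  by rewrite ler_wpM2r ?invr_ge0 ?exprn_ge0// /M; lra.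
- move=> i _; apply: le_trans (obs_py_le i z) _.
  by rewrite ler_wpM2r ?invr_ge0 ?exprn_ge0// /M; lra.
- by move=> i h i1 h1; exact: obs_term_lipschitz.
- by move=> i h _; exact: obs_term_taylor.
Qed.

Lemma continuous_obs : continuous obs.
Proof.
by move=> z; apply: differentiable_continuous; have [] := obs_differentiable z.
Qed.

Lemma measurable_trig_affine (f : R -> R) (a c : R) : continuous f ->
  measurable_fun [set: plane R] (fun z : plane R => f (a * (z.2 + c * z.1)) : R).
Proof.
move=> cf; apply: (measurableT_comp (f := f)); first exact: continuous_measurable_fun.
apply: measurable_funM => //; apply: measurable_funD; first exact: measurable_snd.
by apply: measurable_funM => //; exact: measurable_fst.
Qed.

Lemma measurable_obs_term i : measurable_fun [set: plane R] (obs_term i).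
Proof.
apply: measurable_funM => //.
by apply: measurable_funB; apply: measurable_trig_affine; exact: continuous_sin.
Qed.

Lemma measurable_obs : measurable_fun [set: plane R] (obs : plane R -> R).
Proof.
apply: (@measurable_fun_cvg _ _ _ _ (fun n z => \sum_(1 <= i < n) obs_term i z)).
  by move=> n; apply: measurable_sum => i; exact: measurable_obs_term.
by move=> z _; exact: cvg_obs.
Qed.

Lemma measurable_obs_px i : measurable_fun [set: plane R] (obs_px i : plane R -> R).
Proof.
apply: measurable_funM => //.
apply: measurable_funB; first apply: measurable_funM => //.
  by apply: measurable_trig_affine; exact: continuous_cos.
by apply: measurable_trig_affine; exact: continuous_cos.
Qed.

Lemma measurable_obs_py i : measurable_fun [set: plane R] (obs_py i : plane R -> R).
Proof.
apply: measurable_funM => //.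
by apply: measurable_funB; apply: measurable_trig_affine; exact: continuous_cos.
Qed.

Lemma lebesgue2X (A B : set (line R)) : measurable A -> measurable B ->
  lebesgue2 R (A `*` B) = (@lebesgue_measure R A * @lebesgue_measure R B)%E.
Proof. exact: product_measure1E. Qed.

Lemma lebesgue2_strip : lebesgue2 R (`]0, 1[%classic `*` `[0, 1[%classic) = 1%E.
Proof.
rewrite lebesgue2X// !lebesgue_measure_itv/=.
rewrite !lte_fin ltr01.
by rewrite oppr0 adde0 mule1.
Qed.

(** The sum is bounded by M on the strip, which has measure 1. *)
Lemma square_integrable_series (a : nat -> plane R -> R) (M : R) : 0 <= M ->
  (forall i, measurable_fun [set: plane R] (a i)) ->
  (forall i z, 0 < z.1 < 1 -> `|a i z| <= M * 2 ^- i) ->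
  square_integrable_on (`]0, 1[%classic `*` `[0, 1[%classic)
    (fun z => limn (fun n => \sum_(1 <= i < n) a i z)).
Proof.
move=> M0 ma aM; set D := _ `*` _.
have mD : measurable D by apply: measurableX; exact: measurable_itv.
have Dz z : D z -> 0 < z.1 < 1 by move=> []; rewrite /= in_itv.
have mf : measurable_fun D (fun z => limn (fun n => \sum_(1 <= i < n) a i z)).
  apply: (@measurable_fun_cvg _ _ _ _ (fun n z => \sum_(1 <= i < n) a i z)).
    by move=> n; apply: measurable_sum => i; exact: measurable_funTS.
  move=> z /Dz z1; apply: (is_cvg_series_geometric _ _ _ M0) => i _.
  exact: aM.
split => //.
apply: (@le_lt_trans _ _ (\int[lebesgue2 R]_(z in D) (M ^+ 2)%:E)%E).
  apply: ge0_le_integral => //.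
  - by move=> z _; rewrite lee_fin sqr_ge0.
  - by apply/measurable_EFinP; exact: measurable_funX.
  - move=> z /Dz z1; rewrite lee_fin -ler_sqrt ?sqr_ge0// !sqrtr_sqr.
    rewrite (ger0_norm M0).
    apply: le_trans (norm_series_le_geometric _ _ _ M0 (fun i _ => aM i z z1)) _.
    by rewrite expr1 mulrC mulrA mulVf// mul1r.
by rewrite integral_cst// lebesgue2_strip mule1 ltry.
Qed.

Lemma obs_observable : observable_L2_derivative obs.
Proof.
split.
- exact: obs_periodic.
- by apply: continuous_subspaceT; exact: continuous_obs.
- by move=> z _; have [] := obs_differentiable z.
- rewrite (_ : 'D_(1, 0) obs = (fun z => limn (fun n => \sum_(1 <= i < n) obs_px i z))).
    apply: (@square_integrable_series _ 96) => //.
    + exact: measurable_obs_px.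
    + by move=> i z _; exact: obs_px_le.
  by apply/funext => z; have [] := obs_differentiable z.
- rewrite (_ : 'D_(0, 1) obs = (fun z => limn (fun n => \sum_(1 <= i < n) obs_py i z))).
    apply: (@square_integrable_series _ 512).
    + exact: (ler0n R 512).
    + exact: measurable_obs_py.
    + move=> i z /andP[z0 z1]; apply: le_trans (obs_py_le i z) _.
      rewrite ger0_norm ?(ltW z0)// ler_wpM2r ?invr_ge0 ?exprn_ge0//.
      exact: (ler_piMr (ler0n R 512) (ltW z1)).
  by apply/funext => z; have [] := obs_differentiable z.
Qed.

End Observable.

(** * Integrals of bounded functions, invariance and null sets *)

Section BoundedIntegrands.
Context d (T : measurableType d) (R : realType).

Lemma bounded_integrable (mu : {measure set T -> \bar R}) (D : set T)
    (f : T -> R) (M : R) : measurable D -> (mu D < +oo)%E ->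
  measurable_fun [set: T] f -> (forall x, D x -> `|f x| <= M) ->
  mu.-integrable D (EFin \o f).
Proof.
move=> mD muD mf fM; apply: measurable_bounded_integrable => //.
  exact: measurable_funTS.
exists M; split; first exact: num_real.
by move=> N MN x Dx /=; exact: le_trans (fM x Dx) (ltW MN).
Qed.

Lemma norm_Rintegral_le (mu : {measure set T -> \bar R}) (D : set T)
    (f : T -> R) (M : R) : 0 <= M -> measurable D -> (mu D <= 1)%E ->
  measurable_fun [set: T] f -> (forall x, D x -> `|f x| <= M) ->
  `|\int[mu]_(x in D) f x| <= M.
Proof.
move=> M0 mD muD mf fM.
have Doo : (mu D < +oo)%E by rewrite (le_lt_trans muD)// ltry.
have iB (h : T -> R) : measurable_fun [set: T] h ->
    (forall x, D x -> `|h x| <= M) -> mu.-integrable D (EFin \o h).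
  by move=> mh hM; exact: (bounded_integrable _ _ h M).
apply: le_trans (le_normr_Rintegral mD (iB _ mf fM)) _.
apply: (@le_trans _ _ (\int[mu]_(x in D) cst M x)).
  apply: le_Rintegral => //.
    by apply: iB; [exact: measurableT_comp|move=> x /fM; rewrite normr_id].
  by apply: iB => // x _; rewrite /= ger0_norm.
rewrite Rintegral_cst// ler_piMr// -lee_fin fineK//.
by rewrite ge0_fin_numE.
Qed.

Lemma Rintegral_sum_nat (mu : {measure set T -> \bar R}) (D : set T)
    (f : nat -> T -> R) (m n : nat) : measurable D ->
  (forall i, mu.-integrable D (EFin \o f i)) -> (m <= n)%N ->
  \int[mu]_(x in D) (\sum_(m <= i < n) f i x) =
  \sum_(m <= i < n) \int[mu]_(x in D) f i x.
Proof.
move=> mD fi /subnK <-; elim: (n - m)%N => [|p IH].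
  rewrite add0n big_geq//; under eq_Rintegral do rewrite big_geq//.
  by rewrite Rintegral_cst// mul0r.
rewrite addSn; under eq_Rintegral do rewrite big_nat_recr ?leq_addl//=.
rewrite RintegralD//; first by rewrite IH big_nat_recr ?leq_addl.
apply: (eq_integrable mD (fun x => (\sum_(m <= i < p + m) (f i x)%:E)%E)).
  by move=> x _; rewrite /= sumEFin.
by apply: (integrable_sum mD) => i _; exact: fi.
Qed.

Variable P : probability T R.

Lemma probability_bounded_integrable (D : set T) (f : T -> R) (M : R) :
  measurable D -> measurable_fun [set: T] f ->
  (forall x, D x -> `|f x| <= M) -> P.-integrable D (EFin \o f).
Proof.
move=> mD; apply: bounded_integrable => //.
by rewrite (le_lt_trans (probability_le1 _ mD))// ltry.
Qed.

Lemma Rintegral_conull (D G : set T) (f : T -> R) (M : R) :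
  measurable D -> measurable G -> G `<=` D -> P (~` G) = 0%E ->
  measurable_fun [set: T] f -> (forall x, D x -> `|f x| <= M) ->
  \int[P]_(x in D) f x = \int[P]_(x in G) f x.
Proof.
move=> mD mG GD PG mf fM; rewrite /Rintegral.
rewrite (@negligible_integral _ _ _ _ D (~` G))//.
- by rewrite setDE setCK setIidr.
- exact: measurableC.
- exact: (probability_bounded_integrable _ _ M).
Qed.

Lemma Rintegral_invariant (F : T -> T) (f : T -> R) (M : R) :
  measurable_fun [set: T] F ->
  (forall E, measurable E -> pushforward P F E = P E) ->
  measurable_fun [set: T] f -> (forall x, `|f x| <= M) ->
  \int[P]_x f (F x) = \int[P]_x f x.
Proof.
move=> mF PF mf fM; rewrite /Rintegral; congr fine.
have := @integral_pushforward _ _ _ _ R _ mF P setT (EFin \o f).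
rewrite preimage_setT => <-//.
- by apply: eq_measure_integral => A mA _; exact: PF.
- exact/measurable_EFinP.
- apply: (probability_bounded_integrable _ (f \o F) M) => //.
  + exact: measurableT_comp.
  + by move=> x _; exact: fM.
Qed.

(** A nonnegative function with zero integral vanishes almost everywhere; the conclusion is a
    measurable conull set, so that it can replace G as a domain of integration. *)
Lemma Rintegral_eq0_conull (G : set T) (f : T -> R) (M : R) :
  measurable G -> P (~` G) = 0%E -> measurable_fun [set: T] f ->
  (forall x, G x -> 0 <= f x <= M) -> \int[P]_(x in G) f x = 0 ->
  let G' := G `&` [set x | f x = 0] in measurable G' /\ P (~` G') = 0%E.
Proof.
move=> mG PG mf fM If G'.
have mZ : measurable [set x | f x = 0].
  have -> : [set x | f x = 0] = setT `&` f @^-1` [set 0] by rewrite setTI.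
  by apply: mf => //; exact: measurable_set1.
split; first exact: measurableI.
have fM' x : G x -> `|f x| <= M by move=> /fM /andP[f0 ?]; rewrite ger0_norm.
have Pi := probability_bounded_integrable _ _ _ mG mf fM'.
have H0 : (\int[P]_(x in G) `|(f x)%:E| = 0)%E.
  rewrite -[RHS](_ : (\int[P]_(x in G) f x)%:E = 0%E); last by rewrite If.
  rewrite /Rintegral fineK; last exact: integrable_fin_num.
  apply: eq_integral => x; rewrite inE => Gx /=.
  by rewrite ger0_norm//; have /andP[] := fM _ Gx.
have mfG : measurable_fun G (EFin \o f).
  by apply/measurable_EFinP; exact: measurable_funTS.
have /(ae_eq_integral_abs P mG mfG) [N [mN PN HN]] := H0.
have mGc : measurable (~` G) by exact: measurableC.
have H2 : (P (~` G `|` N) <= 0)%E.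
  have := measureU2 P mGc mN.
  by rewrite [X in (_ <= X + _)%E]PG [X in (_ <= _ + X)%E]PN adde0.
apply/eqP; rewrite -measure_le0; apply: le_trans H2.
apply: le_measure; rewrite ?inE.
- by apply: measurableC; exact: measurableI.
- by apply: measurableU => //; exact: measurableC.
- move=> x; rewrite /G' setCI => -[nG|nf]; [by left|].
  have [Gx|nG] := pselect (G x); last by left.
  by right; apply: HN => /= H; apply: nf => /=; have /= [] := H Gx.
Qed.

End BoundedIntegrands.

(** * Cosines of nonzero integer frequency have mean zero *)

Section CosineIntegral.
Context {R : realType}.
Local Notation leb := (@lebesgue_measure R).

Lemma continuous_cos_affine (a b : R) : continuous (fun y => cos (a * y + b)).
Proof.
move=> y; apply: continuous_comp; last exact: continuous_cos.
by apply: cvgD; [apply: cvgM; [exact: cvg_cst|exact: cvg_id]|exact: cvg_cst].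
Qed.

Lemma Rintegral_cos (m : nat) (b : R) : (1 <= m)%N ->
  \int[leb]_(y in `[0, 1]) cos (2 * pi * m%:R * y + b) = 0.
Proof.
move=> m1; set a := 2 * pi * m%:R.
have a0 : a != 0 by rewrite !mulf_neq0// ?gt_eqF ?pi_gt0// ltr0n.
pose F y : R := a^-1 * sin (a * y + b).
have dF (y : R) : is_derive y 1 F (cos (a * y + b)).
  have D1 : is_derive y 1 (fun y => a * y + b) a.
    by apply: is_derive_eq; rewrite addr0 /GRing.scale/= mulr1.
  have D2 : is_derive y 1 (sin \o (fun y => a * y + b)) (cos (a * y + b) * a).
    exact: is_derive1_comp.
  have : is_derive y 1 (a^-1 *: (sin \o (fun y => a * y + b))) (a^-1 *: (cos (a * y + b) * a)).
    exact: is_deriveZ.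
  by rewrite /GRing.scale/= mulrCA mulVf// mulr1.
have cF : continuous F.
  by move=> y; apply/differentiable_continuous/derivable1_diffP/ex_derive.
rewrite /Rintegral (@continuous_FTC2 _ (fun y => cos (a * y + b)) F 0 1)//.
- rewrite -EFinB /= /F (_ : sin (a * 1 + b) = sin (a * 0 + b)) ?subrr//.
  by rewrite mulr0 mulr1 add0r addrC; exact: (sinD2piz b m).
- by apply: continuous_subspaceT; exact: continuous_cos_affine.
- split.
  + by move=> y _; exact: ex_derive.
  + by apply: cvg_at_right_filter; exact: cF.
  + by apply: cvg_at_left_filter; exact: cF.
- by move=> y _; rewrite derive1E derive_val.
Qed.

End CosineIntegral.

(** * Averages of cosines along the doubling map *)

Section DoublingMap.
Context {R : realType}.
Local Notation leb := (@lebesgue_measure R).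

(** This is cos (2 pi x) after n iterations of [T0], since cosine does not see the integers that
    [T0] removes. *)
Definition cos_pow2 (n : nat) (x : R) : R := cos (2 * pi * (2 ^ n)%:R * x).

Lemma continuous_cos_pow2 n : continuous (cos_pow2 n).
Proof.
move=> x; rewrite /cos_pow2.
under [X in continuous_at _ X]eq_fun do rewrite -[X in cos X]addr0.
exact: continuous_cos_affine.
Qed.

Lemma measurable_cos_pow2 n : measurable_fun [set: line R] (cos_pow2 n).
Proof. by apply: continuous_measurable_fun; exact: continuous_cos_pow2. Qed.

Lemma norm_cos_pow2 n x : `|cos_pow2 n x| <= 1. Proof. exact: cos_max. Qed.

Lemma lebesgue_unit_itv : leb (`[0, 1] : set R) = 1%E.
Proof. by rewrite lebesgue_measure_itv/= lte_fin ltr01 oppr0 adde0. Qed.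

Lemma unit_itv_integrable (f : line R -> R) (M : R) :
  measurable_fun [set: line R] f -> (forall x, `|f x| <= M) ->
  leb.-integrable (`[0, 1] : set R) (EFin \o f).
Proof.
move=> mf fM; apply: (bounded_integrable _ _ _ _ _ _ M) => //.
by rewrite [ltLHS]lebesgue_unit_itv ltry.
Qed.

Lemma Rintegral_cos_pow2M m n : (m < n)%N ->
  \int[leb]_(x in `[0, 1]) (cos_pow2 m x * cos_pow2 n x) = 0.
Proof.
move=> mn.
have E x : cos_pow2 m x * cos_pow2 n x =
    2^-1 * cos (2 * pi * (2 ^ n + 2 ^ m)%:R * x + 0) +
    2^-1 * cos (2 * pi * (2 ^ n - 2 ^ m)%:R * x + 0).
  rewrite !addr0 natrD natrB ?leq_exp2l ?(ltnW mn)//.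
  by rewrite mulrDr mulrBr mulrDl mulrBl cosD cosB /cos_pow2; field.
have mc (k : nat) : measurable_fun [set: line R] (fun x => cos (2 * pi * k%:R * x + 0)).
  by apply: continuous_measurable_fun; exact: continuous_cos_affine.
have ic (k : nat) : leb.-integrable (`[0, 1] : set R)
    (EFin \o (fun x => cos (2 * pi * k%:R * x + 0))).
  by apply: (unit_itv_integrable _ 1); [exact: mc|move=> y; exact: cos_max].
under eq_Rintegral do rewrite E.
rewrite RintegralD//.
- rewrite !RintegralZl// !Rintegral_cos ?mulr0 ?addr0//.
  + by rewrite subn_gt0 ltn_exp2l.
  + by rewrite addn_gt0 expn_gt0.
- have := integrableZl _ (2^-1) (ic (2 ^ n + 2 ^ m)%N); exact.
- have := integrableZl _ (2^-1) (ic (2 ^ n - 2 ^ m)%N); exact.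
Qed.

(** The functions [cos_pow2 n] are pairwise orthogonal on [0, 1], so only N squares survive, each
    with integral at most 1. *)
Lemma Rintegral_sum_cos_pow2 N :
  \int[leb]_(x in `[0, 1]) (\sum_(n < N) cos_pow2 n x) ^+ 2 <= N%:R.
Proof.
have mS k : measurable_fun [set: line R] (fun x => \sum_(n < k) cos_pow2 n x).
  by apply: measurable_sum => n; exact: measurable_cos_pow2.
have bS k x : `|\sum_(n < k) cos_pow2 n x| <= k%:R.
  apply: le_trans (ler_norm_sum _ _ _) _; rewrite -[leRHS]mulr1 mulr_natl.
  rewrite -[X in _ *+ X]card_ord -sumr_const; apply: ler_sum => i _.
  exact: norm_cos_pow2.
have mP k n : measurable_fun [set: line R]
    (fun x => (\sum_(i < k) cos_pow2 i x) * cos_pow2 n x).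
  by apply: measurable_funM; [exact: mS|exact: measurable_cos_pow2].
have iP k n : leb.-integrable (`[0, 1] : set R)
    (EFin \o (fun x => (\sum_(i < k) cos_pow2 i x) * cos_pow2 n x)).
  apply: (unit_itv_integrable _ k%:R (mP k n)) => x.
  by rewrite normrM -[leRHS]mulr1 ler_pM ?bS ?norm_cos_pow2.
have iS k : leb.-integrable (`[0, 1] : set R)
    (EFin \o (fun x => (\sum_(i < k) cos_pow2 i x) ^+ 2)).
  apply: (unit_itv_integrable _ (k%:R ^+ 2)); first exact: measurable_funX.
  by move=> x; rewrite normrX lerXn2r ?nnegrE// bS.
have iC n : leb.-integrable (`[0, 1] : set R) (EFin \o (fun x => (cos_pow2 n x) ^+ 2)).
  apply: (unit_itv_integrable _ 1).
    by apply: measurable_funX; exact: measurable_cos_pow2.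
  by move=> x; rewrite normrX expr_le1// norm_cos_pow2.
(* Induction on the length of the partial sum; k <= n keeps its frequencies different from 2^n. *)
have orth k n : (k <= n)%N ->
    \int[leb]_(x in `[0, 1]) ((\sum_(i < k) cos_pow2 i x) * cos_pow2 n x) = 0.
  elim: k => [_|k IH kn].
    under eq_Rintegral do rewrite big_ord0 mul0r.
    by rewrite Rintegral_cst// mul0r.
  under eq_Rintegral do rewrite big_ord_recr/= mulrDl.
  rewrite RintegralD//.
  - by rewrite IH ?(ltnW kn)// Rintegral_cos_pow2M// addr0.
  - exact: iP.
  - apply: (unit_itv_integrable _ 1).
      by apply: measurable_funM; exact: measurable_cos_pow2.
    by move=> x; rewrite normrM mulr_ile1 ?norm_cos_pow2.
elim: N => [|N IH].
  under eq_Rintegral do rewrite big_ord0 expr0n/=.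
  by rewrite Rintegral_cst// mul0r.
under eq_Rintegral do rewrite big_ord_recr/= sqrrD -mulr_natl.
have iP2 : leb.-integrable (`[0, 1] : set R)
    (EFin \o (fun x => 2 * ((\sum_(i < N) cos_pow2 i x) * cos_pow2 N x))).
  by have := integrableZl _ 2 (iP N N); exact.
have mI : measurable (`[0, 1]%classic : set (line R)) by exact: measurable_itv.
have iSP := integrableD mI (iS N) iP2.
rewrite (RintegralD mI iSP (iC N)) (RintegralD mI (iS N) iP2).
rewrite (RintegralZl 2 mI (iP N N)) orth// mulr0 addr0 -natr1 lerD//.
apply: (@le_trans _ _ (\int[leb]_(x in `[0, 1]) (cst 1 x))).
  apply: le_Rintegral => //.
    by apply: (unit_itv_integrable _ 1) => // x; rewrite normr1.
  by move=> x _; rewrite -(real_normK (num_real (cos_pow2 N x))) expr_le1// norm_cos_pow2.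
by rewrite Rintegral_cst// [X in fine X]lebesgue_unit_itv mulr1.
Qed.

(** The sum [B N] of N cosines has mean N c. By Chebyshev and the bound N on its squared L2 norm,
    |[B N]| >= e N only on a set of Lebesgue measure at most e^-2 / N. For large N this set has
    P-measure below e, so |N c| <= N (e + e). *)
Lemma cos_mean0_of_doubling_invariant (P : probability (plane R) R) (c : R) :
  P (~` (`[0, 1]%classic `*` setT)) = 0%E ->
  (forall e : R, 0 < e -> exists2 d : R, 0 < d & forall A : set (line R),
     measurable A -> (leb A < d%:E)%E -> (P (A `*` setT) < e%:E)%E) ->
  (forall n, \int[P]_z cos_pow2 n z.1 = c) -> c = 0.
Proof.
move=> P01 AC hc.
pose B N x : R := \sum_(n < N) cos_pow2 n x.
have mB N : measurable_fun [set: line R] (B N).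
  by apply: measurable_sum => n; exact: measurable_cos_pow2.
have BN N x : `|B N x| <= N%:R.
  apply: le_trans (ler_norm_sum _ _ _) _; rewrite -[leRHS]mulr1 mulr_natl.
  rewrite -[X in _ *+ X]card_ord -sumr_const; apply: ler_sum => i _.
  exact: norm_cos_pow2.
have mB1 N : measurable_fun [set: plane R] (fun z : plane R => B N z.1).
  by apply: (measurableT_comp (mB N)); exact: measurable_fst.
have iB N (D : set (plane R)) : measurable D ->
    P.-integrable D (EFin \o (fun z : plane R => B N z.1)).
  move=> mD; apply: (probability_bounded_integrable _ _ _ _ _ _ N%:R mD (mB1 N)).
  by move=> z _; exact: BN.
have intB N : \int[P]_z B N z.1 = N%:R * c.
  elim: N => [|N IH].
    rewrite mul0r -[RHS](_ : \int[P]_z (cst 0 z) = 0).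
      by apply: eq_Rintegral => z _; rewrite /B big_ord0.
    by rewrite Rintegral_cst// mul0r.
  under eq_Rintegral do rewrite /B big_ord_recr/=.
  rewrite RintegralD//.
  - by rewrite [X in X + _]IH hc -natr1 mulrDl mul1r.
  - exact: (iB N setT).
  - apply: (probability_bounded_integrable _ _ _ _ _ _ 1) => //.
      by apply: (measurableT_comp (measurable_cos_pow2 N)); exact: measurable_fst.
    by move=> z _; exact: norm_cos_pow2.
apply/eqP; rewrite -normr_le0; apply/ler_addgt0Pr => e' e'0; rewrite add0r.
pose e := e' / 2; have e0 : 0 < e by rewrite divr_gt0.
have [d d0 dP] := AC e e0.
(* Chosen so that the Chebyshev bound e^-2 / N is smaller than d. *)
pose N := (Num.truncn (e ^- 2 / d)).+1.
have N0 : 0 < N%:R :> R by rewrite ltr0n.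
have Nd : e ^- 2 / N%:R < d.
  rewrite ltr_pdivrMr// mulrC -ltr_pdivrMr//; exact: truncnS_gt.
pose A := `[0, 1]%classic `&` [set x | e * N%:R <= `|B N x|].
have mA : measurable A.
  apply: measurableI; first exact: measurable_itv.
  rewrite [X in measurable X](_ : _ = setT `&` (fun x => `|B N x|) @^-1` `[e * N%:R, +oo[).
    by apply: (measurableT_comp (@normr_measurable R setT) (mB N)) => //; exact: measurable_itv.
  by apply/seteqP; split => x /=; rewrite in_itv/= andbT; [split|case].
have lebA : (leb A < d%:E)%E.
  have H : (((e * N%:R) ^+ 2)%:E * leb A <= N%:R%:E)%E.
    rewrite -integral_cst//.
    apply: (@le_trans _ _ (\int[leb]_(x in A) ((B N x) ^+ 2)%:E)%E).
      apply: ge0_le_integral => //.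
      - by move=> x _; rewrite lee_fin sqr_ge0.
      - by apply/measurable_EFinP; apply: measurable_funTS; exact: measurable_funX.
      - move=> x [_ /= eB]; rewrite lee_fin -(real_normK (num_real (B N x))).
        by rewrite lerXn2r// nnegrE// mulr_ge0// ltW.
    apply: (@le_trans _ _ (\int[leb]_(x in `[0%R, 1%R]) ((B N x) ^+ 2)%:E)%E).
      apply: ge0_subset_integral => //.
      - by apply/measurable_EFinP; apply: measurable_funTS; exact: measurable_funX.
      - by move=> x _; rewrite lee_fin sqr_ge0.
      - by move=> x [].
    have i2 : leb.-integrable (`[0, 1] : set R) (EFin \o (fun x => B N x ^+ 2)).
      apply: (unit_itv_integrable _ (N%:R ^+ 2)); first exact: measurable_funX.
      by move=> x; rewrite normrX lerXn2r// nnegrE.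
    have := Rintegral_sum_cos_pow2 N.
    rewrite -lee_fin /Rintegral fineK//.
    apply: (integrable_fin_num _ i2); exact: measurable_itv.
  apply: (@le_lt_trans _ _ (e ^- 2 / N%:R)%:E); last by rewrite lte_fin.
  have q0 : 0 < (e * N%:R) ^+ 2 by rewrite exprn_gt0// mulr_gt0.
  rewrite -(@lee_pmul2l _ ((e * N%:R) ^+ 2)%:E) ?lte_fin//.
  apply: le_trans H _; rewrite -EFinM lee_fin exprMn.
  by rewrite [leRHS](_ : _ = N%:R)//; field; rewrite !gt_eqF.
have PA := dP A mA lebA.
pose D : set (plane R) := `[0, 1]%classic `*` setT.
have mD : measurable D by apply: measurableX => //; exact: measurable_itv.
have mAT : measurable (A `*` [set: line R]) by exact: measurableX.
have mI : measurable_fun [set: plane R] (\1_(A `*` [set: line R]) : plane R -> R).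
  exact: measurable_indic.
suff : `|N%:R * c| <= N%:R * e'.
  by rewrite normrM ger0_norm// ler_pM2l.
rewrite -intB (@Rintegral_conull _ _ _ P setT D _ N%:R)//.
apply: le_trans (le_normr_Rintegral mD _) _; first exact: iB.
(* Dominates |[B N]|, which is below e N off the exceptional set A and at most N everywhere. *)
pose h (z : plane R) : R := N%:R * (e + \1_(A `*` [set: line R]) z).
have mh : measurable_fun [set: plane R] h.
  by apply: measurable_funM => //; apply: measurable_funD.
have I01 z : 0 <= (\1_(A `*` [set: line R]) z : R) <= 1.
  by rewrite indicE; case: (_ \in _); rewrite /= ?lexx ler01.
have ih : P.-integrable D (EFin \o h).
  apply: (probability_bounded_integrable _ _ _ _ _ _ (N%:R * (e + 1))) => // z _.
  have /andP[a b] := I01 z; rewrite ger0_norm; last by rewrite mulr_ge0// addr_ge0// ltW.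
  by rewrite ler_wpM2l// lerD2l.
apply: (@le_trans _ _ (\int[P]_(z in D) h z)).
  apply: le_Rintegral => //.
    apply: (probability_bounded_integrable _ _ _ _ _ _ N%:R) => //.
      exact: measurableT_comp.
    by move=> z _; rewrite normr_id.
  move=> z [/= z1 _]; rewrite /h.
  have [eB|eB] := leP (e * N%:R) `|B N z.1|.
    rewrite indicE mem_set; last by split => //; split.
    apply: le_trans (BN _ _) _; rewrite ler_peMr// lerDr ltW//.
  apply: le_trans (ltW eB) _; rewrite mulrC ler_wpM2l// lerDl.
  by have /andP[] := I01 z.
have PA' : fine (P (A `*` setT)) <= e.
  by rewrite -lee_fin fineK ?ltW// fin_num_measure.
have iI : P.-integrable D (EFin \o (\1_(A `*` [set: line R]) : plane R -> R)).
  apply: (probability_bounded_integrable _ _ _ _ _ _ 1) => // z _.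
  by have /andP[a b] := I01 z; rewrite ger0_norm.
have ie : P.-integrable D (EFin \o cst e).
  by apply: (probability_bounded_integrable _ _ _ _ _ _ `|e|).
rewrite /h RintegralZl//; last first.
  by have := integrableD mD ie iI; exact.
rewrite ler_wpM2l// RintegralD// Rintegral_cst//.
have -> : \int[P]_(z in D) (\1_(A `*` [set: line R]) z : R) = fine (P (A `*` setT)).
  rewrite /Rintegral integral_indic// setIidl//.
  by move=> z [[]].
have : e * fine (P D) <= e.
  rewrite ler_piMr ?(ltW e0)// -lee_fin fineK ?probability_le1//.
  exact: fin_num_measure.
rewrite /e in PA' *; lra.
Qed.

End DoublingMap.

(** * Fractional parts and the formula for [T0] *)

Section Fractional.
Context {R : realType}.
Local Notation frac := Defs.frac.

Lemma fracE (x : R) : frac x = x + (- Num.floor x)%:~R.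
Proof. by rewrite /frac mulrNz. Qed.

Lemma frac_itv (x : R) : 0 <= frac x < 1.
Proof.
rewrite /frac subr_ge0 floor_le_tmp/= ltrBlDl.
by have := floorD1_gt x; rewrite intrD1.
Qed.

Lemma measurable_frac : measurable_fun [set: line R] (@frac R : line R -> line R).
Proof.
apply: (measurable_funB (f := id)) => //.
apply: nondecreasing_measurable => // x y xy.
by rewrite ler_int; exact: Num.Theory.le_floor.
Qed.

Lemma frac_eq (x : R) (n : int) : n%:~R <= x < n%:~R + 1 -> frac x = x - n%:~R.
Proof.
move=> nx; rewrite /frac; congr (_ - _%:~R).
by apply: floor_def; rewrite intrD1.
Qed.

(** On [0, 1[ the indicator [varphi] is the integer part of 2 x. This links the rotation in the
    fibre to the base map and makes the terms of the observable coboundaries. *)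
Lemma T0_doubling (x : R) : 0 <= x < 1 ->
  T0 x = 2 * x - varphi x /\ (varphi x = 0 \/ varphi x = 1).
Proof.
move=> /andP[x0 x1]; rewrite /T0 /varphi indicE.
have [x2|x2] := ltP x (1 / 2).
  rewrite memNset/=; last by rewrite in_itv/= => /andP[/le_lt_trans/(_ x2)]; rewrite ltxx.
  split; last by left.
  by rewrite (frac_eq _ 0)// add0r mulr_ge0//=; lra.
rewrite mem_set/=; last by rewrite in_itv/= x2 ltW.
split; last by right.
by rewrite (frac_eq _ 1)//; apply/andP; split; lra.
Qed.

Lemma sin_frac (m : nat) (a c : R) :
  sin (2 * pi * m%:R * (frac a + c)) = sin (2 * pi * m%:R * (a + c)).
Proof.
rewrite fracE addrAC mulrDr -[RHS](sinD2piz _ (m%:Z * - Num.floor a)).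
by rewrite intrM mulrA.
Qed.

Lemma cos_frac (m : nat) (a c : R) :
  cos (2 * pi * m%:R * (frac a + c)) = cos (2 * pi * m%:R * (a + c)).
Proof.
rewrite fracE addrAC mulrDr -[RHS](cosD2piz _ (m%:Z * - Num.floor a)).
by rewrite intrM mulrA.
Qed.

Lemma cos_pow2_T0 n (x : R) : cos_pow2 n (T0 x) = cos_pow2 n.+1 x.
Proof.
rewrite /cos_pow2 /T0 -[frac _]addr0 cos_frac addr0; congr cos.
by rewrite expnSr natrM; ring.
Qed.

End Fractional.

(** * One step of the perturbation seen on the phase circle *)

Section Trapping.
Context {R : realType}.
Implicit Types r s e c : R.

Lemma cos_ge_small s e : `|s| <= e -> e <= pi -> cos e <= cos s.
Proof.
move=> se epi; rewrite -(cos_norm s).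
have e0 : 0 <= e by exact: le_trans se.
have := @ltr_cos R; rewrite leNgt => H; apply/negP.
rewrite H ?in_itv/= ?normr_ge0 ?e0 ?epi ?(le_trans se)//.
by move=> /lt_le_trans/(_ se); rewrite ltxx.
Qed.

(** Here r is the distance to the attracting phase 0, and the point moves towards it by at most e.
    If r <= e, it is in [-e, e] before and after; otherwise it cannot overshoot, and its distance
    strictly decreases. *)
Let trapping_half r e c : 0 < r < pi -> 0 < e <= pi -> 0 < c <= 1 ->
  (cos e <= cos r /\ cos e <= cos (r - e * c)) \/ cos r < cos (r - e * c).
Proof.
move=> /andP[r0 rpi] /andP[e0 epi] /andP[c0 c1].
have ec : e * c <= e by rewrite ler_piMr// ltW.
have ec0 : 0 < e * c by rewrite mulr_gt0.
have [re|re] := leP r e; [left|right].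
  split; apply: cos_ge_small => //; rewrite ler_norml; lra.
rewrite ltr_cos ?in_itv/=; first by lra.
- by apply/andP; split; lra.
- by apply/andP; split; lra.
Qed.

(* s is the phase of the point in the period of g, e the step of the
   perturbation: either the orbit is already trapped near the attracting point,
   or it sits on the repelling one, or it gets strictly closer to the former *)
Lemma trapping s e c : 0 <= s < pi *+ 2 -> 0 < e <= pi -> `|c| <= 1 ->
  (s = 0 -> c = 0) -> (0 < s < pi -> c < 0) -> (pi < s < pi *+ 2 -> 0 < c) ->
  [\/ cos e <= cos s /\ cos e <= cos (s + e * c), cos s = -1 |
      cos s < cos (s + e * c)].
Proof.
move=> /andP[s0 s2] e0 c1 cz cn cp.
have := c1; rewrite ler_norml => /andP[cN1 cP1].
have [s0'|s0'] := eqVneq s 0.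
  apply: Or31; rewrite cz// s0' mulr0 addr0 cos0.
  by split; exact: cos_le1.
have sp : 0 < s by rewrite lt_neqAle eq_sym s0'.
have [spi|spi|->] := ltgtP s pi; last by apply: Or32; exact: cospi.
- have c0 : c < 0 by apply: cn; rewrite sp spi.
  have := @trapping_half s e (- c); rewrite mulrN opprK sp spi e0 oppr_gt0 c0 lerNl cN1.
  by move=> /(_ isT isT isT) [H|H]; [apply: Or31|apply: Or33].
- have c0 : 0 < c by apply: cp; rewrite spi s2.
  (* Beyond pi the attracting phase is approached at 2 pi; the reflection to 2 pi - s reduces this
     to the first half. *)
  have := @trapping_half (pi *+ 2 - s) e c.
  have E x : cos (pi *+ 2 - x) = cos x :> R by rewrite addrC cosD2pi cosN.
  have -> : pi *+ 2 - s - e * c = pi *+ 2 - (s + e * c) by ring.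
  rewrite !E e0 c0 cP1 subr_gt0 s2/= ltrBlDr mulr2n ltrD2l spi.
  by move=> /(_ isT isT isT) [H|H]; [apply: Or31|apply: Or33].
Qed.

End Trapping.

(** * The perturbed map: approximate coboundaries and trapping *)

Section Dynamics.
Context {R : realType} (j : nat) (g : R -> R).
Hypothesis j1 : (1 <= j)%N.
Hypothesis g_adm : admissible j g.
Local Notation k i := ((period i)%:R : R).
Local Notation d := (delta R j).
Local Notation frac := Defs.frac.

Let g1 t : `|g t| <= 1. Proof. by have [_ _] := g_adm. Qed.

Lemma continuous_adm : continuous g.
Proof.
have [_ sg _ _] := g_adm => y.
by apply/differentiable_continuous/derivable1_diffP; exact: (sg 0%N).
Qed.

Lemma measurable_F_pert :
  measurable_fun [set: plane R] (F_pert j g : plane R -> plane R).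
Proof.
have mphi : measurable_fun [set: line R] (@varphi R : line R -> R).
  by apply: measurable_indic; exact: measurable_itv.
have mw : measurable_fun [set: plane R]
    (fun z : plane R => frac (z.2 + theta_ R j * varphi z.1) : line R).
  apply: (measurableT_comp measurable_frac).
  apply: measurable_funD; first exact: measurable_snd.
  by apply: measurable_funM => //; apply: (measurableT_comp mphi); exact: measurable_fst.
apply: measurable_fun_pair => /=.
  apply: (measurableT_comp measurable_frac).
  by apply: measurable_funM => //; exact: measurable_fst.
apply: (measurableT_comp measurable_frac); apply: measurable_funD => //.
apply: measurable_funM => //; apply: (measurableT_comp _ mw).
by apply: continuous_measurable_fun; exact: continuous_adm.
Qed.

Lemma freqE i : freq R i = 2 * pi * (2 * period i)%:R.
Proof. by rewrite /freq natrM; ring. Qed.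

Lemma freq_theta i : exists n : nat, freq R i * theta_ R i = 2 * pi * n%:R.
Proof.
have [n nE] := period_theta_nat R i; exists (2 * n)%N.
by rewrite /freq -mulrA nE natrM; ring.
Qed.

(** The map rotates by theta_j = theta_i + d_i - d_j. The d_i part cancels the [varphi] in [T0],
    turning the slope d_i into 2 d_i, and theta_i is invisible at this frequency. There remains a
    phase error w_i d_j (g - [varphi]), with |g - [varphi]| <= 2. *)
Lemma almost_coboundary i (z : R * R) : 0 <= z.1 < 1 ->
  let u (z : R * R) := sin (freq R i * (z.2 + delta R i * z.1)) in
  `|sin (freq R i * (z.2 + 2 * delta R i * z.1)) - u (F_pert j g z)|
    <= 2 * freq R i * d.
Proof.
move=> z1; rewrite /F_pert /skew_rotation /D_pert/=.
have [-> phi01] := T0_doubling _ z1.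
set t := frac (z.2 + _); set f := varphi z.1 in phi01 t *.
have [n nE] := freq_theta i.
have -> : sin (freq R i * (frac (t + d * g t) + delta R i * (2 * z.1 - f))) =
    sin (freq R i * (z.2 + 2 * delta R i * z.1) + freq R i * (d * (g t - f))).
  rewrite freqE sin_frac -addrA {1}/t sin_frac -freqE.
  have -> : theta_ R j = theta_ R i + delta R i - d.
    by apply/eqP; rewrite -subr_eq opprK (theta_delta R i j).
  have -> : freq R i * (z.2 + (theta_ R i + delta R i - d) * f +
     (d * g t + delta R i * (2 * z.1 - f))) =
     freq R i * (z.2 + 2 * delta R i * z.1) + freq R i * (d * (g t - f)) +
     (freq R i * theta_ R i) * f by ring.
  rewrite nE; case: phi01 => ->; first by rewrite mulr0 addr0.
  by rewrite mulr1 -[n%:R]/(n%:Z%:~R) sinD2piz.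
apply: le_trans (sin_lipschitz _ _) _.
rewrite opprD addrA subrr add0r normrN normrM (ger0_norm (freq_ge0 _ _)).
rewrite normrM (ger0_norm (delta_ge0 _ _)).
have gf : `|g t - f| <= 2.
  have := g1 t; rewrite !ler_norml; case: phi01 => ->; lra.
rewrite [leRHS](_ : _ = freq R i * (d * 2)); last by ring.
by rewrite !ler_wpM2l ?freq_ge0 ?delta_ge0.
Qed.

(** The bound, since |g| <= 1, for the displacement by [D_pert] of the phase 2 pi k_j y. *)
Definition step : R := 2 * pi * k j * d.

(** k_j^4 d_j <= 2 and k_j >= 16 give k_j d_j <= 2 / 16^3, and 2 pi <= 8. *)
Lemma step_bounds : 0 < step <= 1 / 256.
Proof.
apply/andP; split.
  by rewrite /step !mulr_gt0 ?pi_gt0 ?natr_period_gt0 ?delta_gt0.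
have k16 := natr_period_ge16 R j j1.
have k0 := natr_period_gt0 R j.
have /andP[_ H] := period_delta_bounds R j.
rewrite /step; apply: (@le_trans _ _ (8 * (k j * d))).
  rewrite -!mulrA mulrA ler_wpM2r ?mulr_ge0 ?delta_ge0//.
  by have := @pi_le4 R; lra.
have y16 : 16 ^+ 3 <= k j ^+ 3 by rewrite lerXn2r// nnegrE.
have xy : k j ^+ 3 * (k j * d) <= 2 by rewrite mulrA -exprSr.
have x0 : 0 <= k j * d by rewrite mulr_ge0 ?delta_ge0.
have := le_trans (ler_wpM2r x0 y16) xy; lra.
Qed.

Lemma phase_in_period (w : R) : 0 <= w < 1 ->
  exists2 i, (i < period j)%N &
    exists2 t, w = orbit_pt R j i + t & 0 <= t < (k j)^-1.
Proof.
move=> /andP[w0 w1]; have k0 := natr_period_gt0 R j.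
have wk0 : 0 <= w * k j by rewrite mulr_ge0// ltW.
pose i := Num.truncn (w * k j); exists i.
  rewrite -(ltr_nat R); apply: (@le_lt_trans _ _ (w * k j)); first by rewrite truncn_le.
  by rewrite -[ltRHS]mul1r ltr_pM2r.
exists (w - orbit_pt R j i); first by rewrite addrC subrK.
rewrite /orbit_pt subr_ge0 ler_pdivrMr// truncn_le wk0 ltrBlDl -[X in _ + X]div1r.
by rewrite -mulrDl ltr_pdivlMr// natr1 truncnS_gt.
Qed.

(** Since k_j theta_j is an integer, the rotation leaves the phase 2 pi k_j y unchanged modulo 2 pi,
    and only [D_pert] moves it. *)
Lemma cos_after_rotation (z : R * R) :
  cos (2 * pi * k j * frac (z.2 + theta_ R j * varphi z.1)) =
  cos (2 * pi * k j * z.2).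
Proof.
rewrite -[frac _]addr0 cos_frac addr0.
have [n nE] := period_theta_nat R j.
have -> : 2 * pi * k j * (z.2 + theta_ R j * varphi z.1) =
   2 * pi * k j * z.2 + 2 * pi * ((k j * theta_ R j) * varphi z.1) by ring.
rewrite nE /varphi indicE; case: (_ \in _) => /=; last by rewrite !mulr0 addr0.
by rewrite mulr1 -[n%:R]/(n%:Z%:~R) cosD2piz.
Qed.

Lemma F_pert_trapping (z : R * R) : let c := cos (2 * pi * k j * z.2) in
  let c' := cos (2 * pi * k j * (F_pert j g z).2) in
  [\/ cos step <= c /\ cos step <= c', c = -1 | c < c'].
Proof.
move=> c c'.
have k0 := natr_period_gt0 R j.
pose w := frac (z.2 + theta_ R j * varphi z.1).
have wE : cos (2 * pi * k j * w) = c by exact: cos_after_rotation.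
have w'E : cos (2 * pi * k j * w + step * g w) = c'.
  rewrite /c' /F_pert /skew_rotation /D_pert/= -/w -[frac _]addr0 cos_frac addr0.
  by congr cos; rewrite /step; ring.
have [i ik [t wt /andP[t0 t1]]] := phase_in_period _ (frac_itv (z.2 + theta_ R j * varphi z.1)).
rewrite -/w in wt.
(* The phase of w is that of its offset t from the orbit point on its left, so the sign pattern of g
   on the i-th interval supplies the hypotheses of [trapping]. *)
have phase x : cos (2 * pi * k j * w + x) = cos (2 * pi * k j * t + x).
  have -> : 2 * pi * k j * w + x = 2 * pi * k j * t + x + 2 * pi * i%:R.
    by rewrite wt /orbit_pt; field; rewrite gt_eqF.
  exact: (cosD2piz _ i).
rewrite phase in w'E; have := phase 0; rewrite !addr0 wE => cE.
rewrite cE -w'E.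
have [_ _ _ /(_ i ik) [[gi0 gi2] gN gP _ _]] := g_adm.
have yiS : orbit_pt R j i.+1 = orbit_pt R j i + (k j)^-1.
  by rewrite /orbit_pt -natr1 mulrDl div1r.
have /andP[st0 st1] := step_bounds.
have P0 := @pi_gt0 R.
(* The phases pi and 2 pi are the offsets 1 / (2 k_j) and 1 / k_j in y. *)
have pE : pi = 2 * pi * k j * (1 / (2 * k j)) :> R by field; rewrite gt_eqF.
have p2E : pi *+ 2 = 2 * pi * k j * (k j)^-1 :> R.
  by rewrite -mulr_natl; field; rewrite gt_eqF.
have q0 : 0 < 2 * pi * k j by rewrite !mulr_gt0.
have k20 : (k j)^-1 = 1 / (2 * k j) + 1 / (2 * k j) by field; rewrite gt_eqF.
apply: trapping.
- by rewrite mulr_ge0 ?(ltW q0)//= p2E ltr_pM2l.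
- by rewrite st0/=; have := @pi_ge2 R; lra.
- exact: g1.
- move=> /eqP; rewrite mulf_eq0 (gt_eqF q0)/= => /eqP t00.
  by rewrite wt t00 addr0.
- rewrite pmulr_rgt0// => /andP[t00]; rewrite [ltRHS]pE ltr_pM2l// => t2.
  by apply: gN; rewrite wt ltrDl t00 ltrD2l.
- move=> /andP[+ _]; rewrite [ltLHS]pE ltr_pM2l// => t2.
  by apply: gP; rewrite wt yiS !ltrD2l t2.
Qed.

End Dynamics.

(** * Absolute continuity and null sets for a measure in L1 *)

Section L1Measure.
Context {R : realType} (P : probability (plane R) R).
Hypothesis P_L1 : in_L1 (charge_of_finite_measure P).
Local Notation leb := (@lebesgue_measure R).

Lemma measurable_cylinder : measurable (@cylinder R).
Proof. by apply: measurableX; exact: measurable_itv. Qed.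

Lemma L1_conull_cylinder : P (~` @cylinder R) = 0%E.
Proof.
have [conc _] := P_L1.
have := conc _ (measurableC measurable_cylinder).
by rewrite setICl /charge_of_finite_measure/= => ->; exact: measure0.
Qed.

(** P is at most its positive Jordan part, whose marginal has an integrable density; the integral of
    such a density is small over sets of small measure. *)
Lemma L1_abs_continuous (e : R) : 0 < e -> exists2 d : R, 0 < d &
  forall A : set (line R), measurable A -> (leb A < d%:E)%E ->
  (P (A `*` setT) < e%:E)%E.
Proof.
move=> e0; have [_ [X [N [XN [_ _ [phi [_ [_ [_ [[mphi dphi] _ _ _ _]]]]]]]]]] := P_L1.
have iphi : leb.-integrable setT (EFin \o (fun s => (phi s)%:num)).
  apply/integrableP; split; first exact/measurable_EFinP.
  under eq_integral do rewrite /= ger0_norm//.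
  rewrite -(dphi setT)//= /pushforward preimage_setT.
  by rewrite -ge0_fin_numE// fin_num_measure.
have [d [d0 dP]] := integral_normr_continuous iphi e0.
exists d => // A mA /(dP A mA) H.
have mAT : measurable (A `*` [set: line R]) by exact: measurableX.
apply: (@le_lt_trans _ _ (\int[leb]_(s in A) (phi s)%:num%:E)%E).
  rewrite -dphi// /pushforward.
  have -> : fst @^-1` A = A `*` [set: line R] by apply/seteqP; split => [x|x []].
  have := jordan_decomp XN mAT; rewrite /cadd/= /cscale/= => ->.
  by rewrite EFinN mulN1e geeDl// oppe_le0 measure_ge0.
have iA : leb.-integrable A (EFin \o (fun s => (phi s)%:num)).
  exact: integrableS iphi.
rewrite -[ltLHS]fineK; last exact: integrable_fin_num iA.
rewrite lte_fin; apply: le_lt_trans H; rewrite /Rintegral.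
by under [leRHS]eq_Rintegral do rewrite ger0_norm//.
Qed.

(** The side x = 1 is removed because [T0_doubling] fails there: [T0] sends 1 to 0, whereas 2 * 1 -
    1 = 1. *)
Definition half_open_square : set (plane R) := `[0, 1[%classic `*` `[0, 1[%classic.

Lemma measurable_square : measurable half_open_square.
Proof. by apply: measurableX; exact: measurable_itv. Qed.

Lemma L1_conull_square : P (~` half_open_square) = 0%E.
Proof.
pose B : set (plane R) := [set (1 : R)] `*` [set: R].
have P1 : P B = 0%E.
  apply/eqP; rewrite -measure_le0; apply/lee_addgt0Pr => e e0; rewrite add0e.
  have [d d0 dP] := L1_abs_continuous e e0.
  by apply/ltW/dP => //; rewrite lebesgue_measure_set1 lte_fin.
have m1 : measurable B.
  by apply: measurableX => //; exact: measurable_set1.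
have mC := measurableC measurable_cylinder.
apply/eqP; rewrite -measure_le0.
have H : (P (~` @cylinder R `|` B) <= 0)%E.
  have := measureU2 P mC m1.
  by rewrite [X in (_ <= X + _)%E]L1_conull_cylinder [X in (_ <= _ + X)%E]P1 adde0.
apply: le_trans H; apply: le_measure; rewrite ?inE.
- exact: measurableC measurable_square.
- exact: measurableU.
- move=> [x y] /= nG; have [->|x1] := eqVneq x 1; [by right|left] => -[/= H1 H2].
  apply: nG; split => //=; move: H1; rewrite !in_itv/= => /andP[-> H1].
  by rewrite lt_neqAle x1.
Qed.

End L1Measure.

(** * Pointwise lower bound for the resonant term *)

Section MainTerm.
Context {R : realType}.
Local Notation k i := ((period i)%:R : R).

(** With e = [step j] and p the phase, the term is 2 k_j cos (2 p + 3 e x) sin (e x), the cosine is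
    at least 1 / 2 and the sine at least e x / 2. The bound is expressed through 1 - cos (2 pi x) <=
    8 x because the mean of this function is known. *)
Lemma main_term_pointwise (j : nat) (z : plane R) : (1 <= j)%N -> half_open_square z ->
  cos (step j) <= cos (2 * pi * k j * z.2) \/ cos (2 * pi * k j * z.2) = -1 ->
  k j * step j / 16 * (1 - cos (2 * pi * z.1)) <= obs_term R j z.
Proof.
move=> j1 [/= + _] H; rewrite in_itv/= => /andP[x0 x1].
have /andP[e0 e1] := @step_bounds R j j1.
have k0 := natr_period_gt0 R j.
rewrite obs_termE; set e := step j in H e0 e1 *; set x := z.1 in x0 x1 *.
have wd : freq R j * delta R j = 2 * e by rewrite /freq /e /step; ring.
clearbody e.
have -> : freq R j * delta R j * x / 2 = e * x by rewrite wd; field.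
have -> : freq R j * (z.2 + 3 / 2 * delta R j * x) =
    2 * pi * k j * z.2 *+ 2 + 3 * (e * x).
  rewrite mulrDr [X in _ + X](_ : _ = freq R j * delta R j * (3 / 2 * x)); last by ring.
  by rewrite wd /freq; field.
set p := 2 * pi * k j * z.2 in H *.
have ex0 : 0 <= e * x by rewrite mulr_ge0// ltW.
have exe : e * x <= e by rewrite ler_piMr// ltW.
have sx : e * x / 2 <= sin (e * x) by apply: sin_ge_half; lra.
(* Doubling the angle multiplies the defect e^2 / 2 by at most 4, and sends the repelling phase pi
   to 2 pi, where the cosine is 1. *)
have C : 1 - 2 * e ^+ 2 <= cos (p *+ 2).
  rewrite cos_mulr2n; case: H => [H|->]; last by have := sqr_ge0 e; lra.
  have H1 := cos_ge_quadratic e.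
  have H2 : e ^+ 2 <= 1 / 256 by nra.
  have : (1 - e ^+ 2 / 2) ^+ 2 <= cos p ^+ 2.
    by rewrite lerXn2r ?nnegrE//; lra.
  by have := sqr_ge0 (e ^+ 2); lra.
have S : `|sin (p *+ 2)| <= 2 * e.
  have e2 : 0 <= 2 * e by rewrite mulr_ge0// ltW.
  rewrite -(ger0_norm e2) -!sqrtr_sqr ler_sqrt ?sqr_ge0// sin2cos2.
  have := cos_le1 (p *+ 2); have := cos_geN1 (p *+ 2); move: C; clear; nra.
have A1 := cos_ge_quadratic (3 * (e * x)).
have A2 := norm_sin_le (3 * (e * x)).
have cosP : 1 / 2 <= cos (p *+ 2 + 3 * (e * x)).
  rewrite cosD.
  rewrite (@ger0_norm _ (3 * (e * x))) in A2; last by rewrite mulr_ge0.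
  have A3 : 9 / 10 <= cos (3 * (e * x)) by nra.
  have C3 : 9 / 10 <= cos (p *+ 2) by nra.
  have SS : `|sin (p *+ 2) * sin (3 * (e * x))| <= 1 / 10.
    rewrite normrM; apply: (@le_trans _ _ ((2 * e) * (3 * (e * x)))).
      exact: ler_pM.
    nra.
  have := ler_norm (sin (p *+ 2) * sin (3 * (e * x))).
  nra.
have X : 1 - cos (2 * pi * x) <= 8 * x.
  have := cos_lipschitz (2 * pi * x) 0; rewrite cos0 subr0.
  rewrite (@ger0_norm _ (2 * pi * x)) ?mulr_ge0 ?pi_ge0// distrC => H0.
  apply: le_trans (ler_norm _) _; apply: le_trans H0 _.
  by rewrite ler_wpM2r//; have := @pi_le4 R; lra.
apply: (@le_trans _ _ (k j * e / 16 * (8 * x))).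
  by rewrite ler_wpM2l// mulr_ge0// mulr_ge0 ?(ltW e0).
have -> : k j * e / 16 * (8 * x) = 2 * k j * (1 / 2 * (e * x / 2)) by field.
rewrite ler_wpM2l ?mulr_ge0// ler_pM// ?divr_ge0//.
Qed.

End MainTerm.

(** * Integrals against an invariant measure of the perturbed map *)

Section InvariantMeasure.
Context {R : realType} (j : nat) (g : R -> R) (P : probability (plane R) R).
Hypothesis j1 : (1 <= j)%N.
Hypothesis g_adm : admissible j g.
Hypothesis P_L1 : in_L1 (charge_of_finite_measure P).
Hypothesis P_inv : invariant_measure (F_pert j g) P.
Local Notation k i := ((period i)%:R : R).
Local Notation d := (delta R j).
Local Notation G := (@half_open_square R).
Local Notation F := (F_pert j g).

Let mF : measurable_fun [set: plane R] (F : plane R -> plane R).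
Proof. exact: measurable_F_pert. Qed.

Let mG : measurable G. Proof. exact: measurable_square. Qed.
Let PG : P (~` G) = 0%E. Proof. exact: L1_conull_square. Qed.

Let integrable_G (f : plane R -> R) (M : R) (D : set (plane R)) : measurable D ->
  measurable_fun [set: plane R] f -> (forall z, D z -> `|f z| <= M) ->
  P.-integrable D (EFin \o f).
Proof. by move=> mD mf fM; exact: (probability_bounded_integrable _ _ _ _ _ _ M). Qed.

Let conull (f : plane R -> R) (M : R) : measurable_fun [set: plane R] f ->
  (forall z, `|f z| <= M) -> \int[P]_z f z = \int[P]_(z in G) f z.
Proof.
by move=> mf fM; apply: (Rintegral_conull _ _ _ _ _ _ _ M) => // z _; exact: fM.
Qed.

Let invariant_G (f : plane R -> R) (M : R) : measurable_fun [set: plane R] f ->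
  (forall z, `|f z| <= M) -> \int[P]_(z in G) f (F z) = \int[P]_(z in G) f z.
Proof.
move=> mf fM; rewrite -(conull f M)// -(conull (f \o F) M)//.
- exact: (Rintegral_invariant _ _ _ _ _ _ M mF P_inv mf fM).
- exact: measurableT_comp.
- by move=> z; exact: fM.
Qed.

Let fine_P_G : fine (P G) = 1.
Proof.
have mGc := measurableC mG.
have := measureU2 P mG mGc; rewrite setUCr [X in (X <= _)%E](@probability_setT _ _ _ P).
rewrite [X in (_ <= _ + X)%E]PG adde0 => H.
have : P G = 1%E by apply/eqP; rewrite eq_le H probability_le1.
by move=> ->.
Qed.

(** The first coordinate evolves by [T0], so invariance gives all [cos_pow2 n] the same mean. *)
Lemma cos_mean0 : \int[P]_(z in G) cos (2 * pi * z.1) = 0.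
Proof.
have mc n : measurable_fun [set: plane R] (fun z : plane R => cos_pow2 n z.1).
  by apply: (measurableT_comp (measurable_cos_pow2 n)); exact: measurable_fst.
have b n (z : plane R) : `|cos_pow2 n z.1| <= 1 by exact: norm_cos_pow2.
have H n : \int[P]_z cos_pow2 n z.1 = \int[P]_(z in G) cos (2 * pi * z.1).
  elim: n => [|n IH].
    rewrite (conull _ _ (mc 0%N) (b 0%N)); apply: eq_Rintegral => z _.
    by rewrite /cos_pow2 expn0 mulr1.
  rewrite -IH -[RHS](Rintegral_invariant _ (plane R) _ P F _ 1 mF P_inv (mc n) (b n)).
  by apply: eq_Rintegral => z _; rewrite /F_pert/= cos_pow2_T0.
apply: (cos_mean0_of_doubling_invariant P) H; last exact: L1_abs_continuous.
apply/eqP; rewrite -measure_le0 -[leRHS]PG; apply: le_measure; rewrite ?inE.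
- by apply: measurableC; apply: measurableX => //; exact: measurable_itv.
- exact: measurableC.
- move=> [x y] /= nz [/= H1 H2]; apply: nz; split => //=.
  by move: H1; rewrite !in_itv/= => /andP[-> /ltW].
Qed.

Lemma obs_term_norm i (z : plane R) : G z -> `|obs_term R i z| <= 16 * k i ^+ 2 * delta R i.
Proof.
move=> [/= + _]; rewrite in_itv/= => /andP[x0 x1].
apply: le_trans (obs_term_bound R i z) _; rewrite ger0_norm//.
apply: (ler_piMr _ (ltW x1)).
exact: (mulr_ge0 (mulr_ge0 (ler0n R 16) (exprn_ge0 2 (ltW (natr_period_gt0 R i))))
  (delta_ge0 R i)).
Qed.

(** The term is k_i (s - u), and invariance replaces the mean of u by that of u composed with the
    map, so [almost_coboundary] applies. *)
Lemma lower_frequency_terms i :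
  `|\int[P]_(z in G) obs_term R i z| <= 32 * k i ^+ 2 * d.
Proof.
pose s (z : plane R) : R := sin (freq R i * (z.2 + 2 * delta R i * z.1)).
pose u (z : plane R) : R := sin (freq R i * (z.2 + delta R i * z.1)).
have ms : measurable_fun [set: plane R] s.
  exact: (measurable_trig_affine R sin _ _ (@continuous_sin R)).
have mu : measurable_fun [set: plane R] u.
  exact: (measurable_trig_affine R sin _ _ (@continuous_sin R)).
have muF : measurable_fun [set: plane R] (u \o F) by exact: measurableT_comp.
have s1 z : `|s z| <= 1 by exact: sin_max.
have u1 z : `|u z| <= 1 by exact: sin_max.
have is_ : P.-integrable G (EFin \o s) by exact: (integrable_G s 1).
have iu : P.-integrable G (EFin \o u) by exact: (integrable_G u 1).
have iuF : P.-integrable G (EFin \o (u \o F)).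
  by apply: (integrable_G _ 1) => // z _; exact: u1.
have -> : \int[P]_(z in G) obs_term R i z = k i * \int[P]_(z in G) (s z - u (F z)).
  rewrite (RintegralB mG is_ iuF) (invariant_G u 1)// -(RintegralB mG is_ iu).
  rewrite -RintegralZl//.
  by have := integrableB mG is_ iu; exact.
rewrite normrM ger0_norm//.
have w0 := freq_ge0 R i; have wk := freq_le R i.
have H : `|\int[P]_(z in G) (s z - u (F z))| <= 2 * freq R i * d.
  apply: norm_Rintegral_le => //.
  - by rewrite mulr_ge0 ?delta_ge0// mulr_ge0.
  - exact: probability_le1.
  - exact: measurable_funB.
  - by move=> z [/= + _]; rewrite in_itv/=; exact: almost_coboundary.
apply: le_trans (ler_wpM2l (ler0n R (period i)) H) _.
have -> : k i * (2 * freq R i * d) = 2 * k i * d * freq R i by ring.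
have -> : 32 * k i ^+ 2 * d = 2 * k i * d * (16 * k i) by ring.
by rewrite ler_wpM2l// mulr_ge0 ?delta_ge0// mulr_ge0.
Qed.

(** [U] never decreases under the map, by [F_pert_trapping], and its increment has mean zero by
    invariance, so the increment vanishes almost everywhere. Below the level cos ([step j]) and off
    the repelling orbit it would be strictly positive. *)
Lemma trapped_conull : exists G', [/\ measurable G', P (~` G') = 0%E, G' `<=` G &
  forall z, G' z -> cos (step j) <= cos (2 * pi * k j * z.2) \/
    cos (2 * pi * k j * z.2) = -1].
Proof.
pose c (z : plane R) : R := cos (2 * pi * k j * z.2).
pose U (z : plane R) : R := Num.min (c z) (cos (step j)).
have mc : measurable_fun [set: plane R] c.
  apply: (measurableT_comp (f := cos)).
    by apply: continuous_measurable_fun; exact: continuous_cos.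
  by apply: measurable_funM => //; exact: measurable_snd.
have mU : measurable_fun [set: plane R] U by exact: measurable_minr.
have U1 z : `|U z| <= 1.
  by rewrite /U; case: (leP (c z) (cos (step j))) => _; exact: cos_max.
have mUF : measurable_fun [set: plane R] (U \o F) by exact: measurableT_comp.
have iU : P.-integrable G (EFin \o U) by exact: (integrable_G U 1).
have iUF : P.-integrable G (EFin \o (U \o F)).
  by apply: (integrable_G _ 1) => // z _; exact: U1.
have UF z : 0 <= U (F z) - U z <= 2.
  apply/andP; split; last first.
    by have := U1 z; have := U1 (F z); rewrite !ler_norml; lra.
  rewrite subr_ge0 /U /c; have := F_pert_trapping _ _ j1 g_adm z.
  have := cos_geN1 (2 * pi * k j * (F z).2); have := cos_geN1 (step j : R).
  move: (cos (2 * pi * k j * z.2)) (cos (2 * pi * k j * (F z).2)) (cos (step j)) => a b e.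
  by case: (leP a e); case: (leP b e) => ? ? ? ? [[? ?]|?|?]; lra.
have I0 : \int[P]_(z in G) (U (F z) - U z) = 0.
  by rewrite (RintegralB mG iUF iU) (invariant_G U 1)// subrr.
have mD : measurable_fun [set: plane R] (fun z => U (F z) - U z).
  exact: measurable_funB.
have [mG' PG'] := Rintegral_eq0_conull _ _ _ P G _ 2 mG PG mD (fun z _ => UF z) I0.
exists (G `&` [set z | U (F z) - U z = 0]); split => // z [_ /= /eqP].
rewrite subr_eq0 => /eqP.
rewrite /U /c; have := F_pert_trapping _ _ j1 g_adm z.
have := cos_geN1 (2 * pi * k j * (F z).2); have := cos_geN1 (step j : R).
move: (cos (2 * pi * k j * z.2)) (cos (2 * pi * k j * (F z).2)) (cos (step j)) => a b e.
have [ea _ _ _ _|ae] := leP e a; first by left.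
case: (leP b e) => ? ? ? [[? ?]|?|?] ?; try (by right); lra.
Qed.

(** Integrating the pointwise bound, 1 - cos (2 pi x) has mean 1, which leaves k_j [step j] / 16 =
    pi k_j^2 d_j / 8, and pi >= 2. *)
Lemma main_term : k j ^+ 2 * d / 4 <= \int[P]_(z in G) obs_term R j z.
Proof.
have [G' [mG' PG' G'G tr]] := trapped_conull.
have mo := measurable_obs_term R j.
have bo := obs_term_norm j.
rewrite (Rintegral_conull _ _ _ _ G G' _ _ mG mG' G'G PG' mo bo).
pose h (z : plane R) : R := k j * step j / 16 * (1 - cos (2 * pi * z.1)).
have mcos : measurable_fun [set: plane R] (fun z : plane R => cos (2 * pi * z.1)).
  apply: (measurableT_comp (f := cos)).
    by apply: continuous_measurable_fun; exact: continuous_cos.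
  by apply: measurable_funM => //; exact: measurable_fst.
have m1cos : measurable_fun [set: plane R] (fun z : plane R => 1 - cos (2 * pi * z.1)).
  exact: measurable_funB.
have mh : measurable_fun [set: plane R] h by exact: measurable_funM.
have c0 : 0 <= k j * step j / 16.
  by have /andP[e0 _] := @step_bounds R j j1; rewrite divr_ge0// mulr_ge0// ltW.
have b1 (z : plane R) : `|1 - cos (2 * pi * z.1)| <= 2.
  have := cos_max (2 * pi * z.1); rewrite !ler_norml; lra.
have bh (z : plane R) : `|h z| <= k j * step j / 16 * 2.
  by rewrite /h normrM (ger0_norm c0) ler_wpM2l.
apply: (@le_trans _ _ (\int[P]_(z in G') h z)); last first.
  apply: le_Rintegral => //.
  - exact: (integrable_G h _ G' mG' mh (fun z _ => bh z)).
  - by apply: (integrable_G _ _ G' mG' mo) => z /G'G; exact: bo.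
  - by move=> z G'z; apply: main_term_pointwise => //; [exact: G'G|exact: tr].
rewrite -(Rintegral_conull _ _ _ _ G G' _ _ mG mG' G'G PG' mh (fun z _ => bh z)).
have i1 : P.-integrable G (EFin \o cst 1).
  by apply: (integrable_G _ 1) => // z _; rewrite normr1.
have ic : P.-integrable G (EFin \o (fun z : plane R => cos (2 * pi * z.1))).
  by apply: (integrable_G _ 1) => // z _; exact: cos_max.
have i1c : P.-integrable G (EFin \o (fun z : plane R => 1 - cos (2 * pi * z.1))).
  by apply: (integrable_G _ 2) => // z _; exact: b1.
rewrite (RintegralZl _ mG i1c) (RintegralB mG i1 ic) cos_mean0 subr0.
rewrite Rintegral_cst// fine_P_G mul1r mulr1 /step.
have := @pi_ge2 R; have : 0 <= k j ^+ 2 * d by rewrite mulr_ge0 ?delta_ge0// exprn_ge0.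
have -> : k j * (2 * pi * k j * d) / 16 = pi * (k j ^+ 2 * d) / 8 by field.
move: (k j ^+ 2 * d) => q; nra.
Qed.

End InvariantMeasure.

(** * Tail of the series, Lebesgue means and the final comparison *)

Section Conclusion.
Context {R : realType}.
Local Notation k i := ((period i)%:R : R).
Local Notation leb := (@lebesgue_measure R).

Lemma obs_tail j (z : plane R) : `|z.1| <= 1 ->
  `|obs R z - \sum_(1 <= i < j.+1) obs_term R i z| <= 64 / k j.+1 ^+ 2.
Proof.
move=> z1.
have k0 := natr_period_gt0 R j.+1.
(* The i-th term is at most 32 / k_i^2; one factor 1 / k_i is bounded by 1 / k_(j+1), the other
   geometrically by [period_inv_le]. *)
pose C := 32 * (k j.+1)^-1 * ((k j.+1)^-1 * 2 ^+ j.+1).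
have C0 : 0 <= C.
  apply: mulr_ge0; first by rewrite mulr_ge0// invr_ge0 ltW.
  by rewrite mulr_ge0 ?exprn_ge0// invr_ge0 ltW.
have oC i : (j.+1 <= i)%N -> `|obs_term R i z| <= C * 2 ^- i.
  move=> ji; apply: le_trans (obs_term_bound R i z) _.
  have ki := natr_period_gt0 R i.
  have d0 := delta_ge0 R i.
  have kd : k i ^+ 2 * delta R i <= 2 / k i ^+ 2.
    rewrite ler_pdivlMr ?exprn_gt0// mulrAC -exprD.
    by have /andP[_] := period_delta_bounds R i.
  have kk : (k i)^-1 <= (k j.+1)^-1.
    rewrite lef_pV2 ?posrE// ler_nat.
    apply: leq_trans (period_geometric _ _ ji).
    by rewrite leq_pmulr// expn_gt0.
  have kg := period_inv_le R _ _ ji.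
  have kV : 0 <= (k i)^-1 by rewrite invr_ge0 ltW.
  have -> : C * 2 ^- i = 16 * (2 * ((k j.+1)^-1 * ((k j.+1)^-1 * 2 ^+ j.+1 * 2 ^- i))).
    by rewrite /C; ring.
  have -> : 16 * k i ^+ 2 * delta R i * `|z.1| = 16 * (k i ^+ 2 * delta R i * `|z.1|).
    by ring.
  rewrite ler_wpM2l//; apply: (@le_trans _ _ (k i ^+ 2 * delta R i)).
    by rewrite ler_piMr// mulr_ge0// exprn_ge0// ltW.
  apply: le_trans kd _; rewrite ler_wpM2l// expr2 invfM.
  by rewrite ler_pM.
rewrite /obs (limn_series_split _ _ j.+1)//; last exact: cvg_obs.
rewrite addrC addKr.
apply: le_trans (norm_series_le_geometric _ _ _ C0 oC) _.
by rewrite /C le_eqVlt; apply/orP; left; apply/eqP; field; rewrite gt_eqF// expf_neq0.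
Qed.

(** Stated for a general measure so that it serves both Lebesgue measure and the invariant one. *)
Lemma Rintegral_obs_decomp (mu : {measure set (plane R) -> \bar R})
    (D : set (plane R)) j : measurable D -> (mu D <= 1)%E ->
  (forall z, D z -> `|z.1| <= 1) ->
  `|\int[mu]_(z in D) obs R z -
    \sum_(1 <= i < j.+1) \int[mu]_(z in D) obs_term R i z| <= 64 / k j.+1 ^+ 2.
Proof.
move=> mD muD D1.
have Doo : (mu D < +oo)%E by rewrite (le_lt_trans muD)// ltry.
have iO i : mu.-integrable D (EFin \o obs_term R i).
  apply: (bounded_integrable _ _ _ _ _ _ (32 * 2 ^- i) mD Doo (measurable_obs_term R i)).
  move=> z /D1 z1; apply: le_trans (obs_term_geometric R i z) _.
  by rewrite ler_wpM2r ?invr_ge0 ?exprn_ge0// ler_piMr.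
have mS : measurable_fun [set: plane R] (fun z => \sum_(1 <= i < j.+1) obs_term R i z).
  by apply: measurable_sum => i; exact: measurable_obs_term.
have iS : mu.-integrable D (EFin \o (fun z => \sum_(1 <= i < j.+1) obs_term R i z)).
  apply: (eq_integrable mD (fun z => (\sum_(1 <= i < j.+1) (obs_term R i z)%:E)%E)).
    by move=> z _; rewrite /= sumEFin.
  by apply: (integrable_sum mD) => i _; exact: iO.
have iobs : mu.-integrable D (EFin \o obs R).
  apply: (bounded_integrable _ _ _ _ _ _ 32 mD Doo (measurable_obs R)).
  move=> z /D1 z1; apply: le_trans (norm_series_le_geometric _ (32 * `|z.1|) 1 _ _) _.
  - by rewrite mulr_ge0.
  - by move=> i _; exact: obs_term_geometric.
  - rewrite expr1 -mulrA mulrCA mulfV// mulr1 ler_piMr//.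
rewrite -Rintegral_sum_nat// -(RintegralB mD iobs iS).
apply: norm_Rintegral_le => //.
- by apply: measurable_funB => //; exact: measurable_obs.
- by move=> z /D1; exact: obs_tail.
Qed.

Lemma lebesgue2_cylinder : lebesgue2 R (@cylinder R) = 1%E.
Proof.
rewrite lebesgue2X// !lebesgue_measure_itv/= !lte_fin ltr01.
by rewrite oppr0 adde0 mule1.
Qed.

(** By Fubini: on each fibre of fixed x the product form is a constant times a cosine of integer
    frequency 2 k_i in y. *)
Lemma Rintegral_lebesgue_obs_term i :
  \int[lebesgue2 R]_(z in @cylinder R) obs_term R i z = 0.
Proof.
have mc := @measurable_cylinder R.
pose f : plane R -> \bar R := (EFin \o obs_term R i) \_ (@cylinder R).
have Doo : (lebesgue2 R (@cylinder R) < +oo)%E by rewrite lebesgue2_cylinder ltry.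
have iO : (lebesgue2 R).-integrable (@cylinder R) (EFin \o obs_term R i).
  apply: (bounded_integrable _ _ _ _ _ _ (32 * 2 ^- i) mc Doo (measurable_obs_term R i)).
  move=> z [/= + _]; rewrite in_itv/= => /andP[z0 z1].
  apply: le_trans (obs_term_geometric R i z) _.
  by rewrite ler_wpM2r ?invr_ge0 ?exprn_ge0// ger0_norm// ler_piMr.
have fi : (lebesgue2 R).-integrable setT f by exact/(integrable_mkcond _ mc).
rewrite /Rintegral integral_mkcond -/f.
have <- := @integral12_prod_meas1 _ _ _ _ R leb leb f fi.
rewrite integral0_eq// => x _; rewrite /fubini_F.
have [x01|x01] := boolP (x \in `[0%R, 1%R]); last first.
  rewrite integral0_eq// => y _; rewrite /f patchE memNset//.
  by move=> [/= H _]; rewrite H in x01.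
pose h y := 2 * k i * sin (freq R i * delta R i * x / 2) *
  cos (2 * pi * (2 * period i)%:R * y + freq R i * (3 / 2 * delta R i * x)).
have -> : (fun y => f (x, y)) = (EFin \o h) \_ `[0%R, 1%R[.
  apply/funext => y; rewrite /f !patchE.
  have -> : ((x, y) \in @cylinder R) = (y \in `[0%R, 1%R[%classic).
    by apply/idP/idP; rewrite !inE => /=; [case|split].
  case: ifP => // _; rewrite /= obs_termE/= /h -freqE; congr (_%:E).
  by rewrite mulrDr; ring.
rewrite -integral_mkcond.
pose A : R := 2 * k i * sin (freq R i * delta R i * x / 2).
pose h' y := cos (2 * pi * (2 * period i)%:R * y + freq R i * (3 / 2 * delta R i * x)).
have mh' : measurable_fun [set: line R] h'.
  by apply: continuous_measurable_fun; exact: continuous_cos_affine.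
have ih' : leb.-integrable (`[0, 1] : set R) (EFin \o h').
  by apply: (unit_itv_integrable _ 1 mh') => y; exact: cos_max.
have mI : measurable (`[0, 1] : set (line R)) by exact: measurable_itv.
have ih : leb.-integrable (`[0, 1] : set R) (EFin \o h).
  by have := integrableZl mI A ih'; exact.
have ih1 : leb.-integrable (`[0, 1[ : set R) (EFin \o h).
  apply: integrableS ih => // y /=.
  by rewrite !in_itv/= => /andP[-> /ltW].
rewrite -[LHS]fineK; last by apply: integrable_fin_num ih1.
congr (_%:E).
rewrite -/(Rintegral leb `[0%R, 1%R[ h) Rintegral_itv_bndo_bndc//.
rewrite (RintegralZl A mI ih') Rintegral_cos ?mulr0//.
by rewrite muln_gt0 period_gt0.
Qed.

(** k_(j+1)^2 = k_j^6 k_j^2 with k_j^6 >= 16^6. The constant 1024 = 32 * 32 brings the sum of the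
    bounds 32 k_i^2 d_j down to k_j^2 d_j / 32. *)
Lemma sum_sqr_period_le j : (1 <= j)%N ->
  \sum_(1 <= i < j) k i ^+ 2 <= k j ^+ 2 / 1024.
Proof.
elim: j => // -[_ _|j IH _].
  rewrite (big_geq (leqnn 1)); exact: (divr_ge0 (exprn_ge0 2 (ler0n R _)) (ler0n R 1024)).
rewrite big_nat_recr//=; have := IH isT; set q := k j.+1 ^+ 2; rewrite -/q => {}IH.
have q16 : 16 ^+ 6 <= k j.+1 ^+ 6 by rewrite lerXn2r ?nnegrE// natr_period_ge16.
have q0 : 0 <= q by rewrite exprn_ge0.
have -> : k j.+2 ^+ 2 = k j.+1 ^+ 6 * q.
  by rewrite periodS natrX /q; ring.
have := ler_wpM2r q0 q16; lra.
Qed.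

End Conclusion.

Theorem proposition34 (R : realType)
    (g : nat -> R -> R)
    (g_adm : forall j, (1 <= j)%N -> admissible j (g j))
    (mu : nat -> probability (plane R) R)
    (mu_L1 : forall j, (1 <= j)%N -> in_L1 (charge_of_finite_measure (mu j)))
    (mu_inv : forall j, (1 <= j)%N -> invariant_measure (F_pert j (g j)) (mu j)) :
  exists (psi : R * R -> R) (C : R),
    [/\ observable_L2_derivative psi,
        0 < C &
        forall j, (1 <= j)%N ->
          C * Num.sqrt (delta R j) <=
          `| \int[@lebesgue2 R]_(z in @cylinder R) psi z
             - \int[mu j]_(z in @cylinder R) psi z |].
Proof.
(* In units of k_j^2 d_j the main term is at least 1 / 4, the lower terms are at most 1 / 32 and the
   two tails at most 1 / 1024 each, which leaves more than 1 / 8. *)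
exists (obs R), (1 / 8); split; [exact: obs_observable|by rewrite divr_gt0|].
move=> j j1; have gj := g_adm j j1; have Lj := mu_L1 j j1; have Ij := mu_inv j j1.
set k : R := (period j)%:R; set d := delta R j.
have mc := @measurable_cylinder R.
have cyl1 (z : plane R) : cylinder z -> `|z.1| <= 1.
  by move=> [/= + _]; rewrite in_itv/= => /andP[z0 z1]; rewrite ger0_norm.
have kS : (period j.+1)%:R = k ^+ 4 :> R by rewrite periodS natrX.
have := Rintegral_obs_decomp (lebesgue2 R) (@cylinder R) j mc.
rewrite lebesgue2_cylinder lexx => /(_ isT cyl1).
under eq_bigr do rewrite Rintegral_lebesgue_obs_term.
rewrite big1// subr0 kS.
set I0 := \int[_]_(z in _) _ => H0.
have := Rintegral_obs_decomp (mu j) (@cylinder R) j mc (probability_le1 _ mc) cyl1.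
rewrite big_nat_recr//= kS.
have cG i : \int[mu j]_(z in @cylinder R) obs_term R i z =
    \int[mu j]_(z in half_open_square) obs_term R i z.
  apply: (Rintegral_conull _ _ _ _ _ _ _ (32 * 2 ^- i) mc measurable_square).
  - by move=> z [/= H1 H2]; split => //=; move: H1; rewrite !in_itv/= => /andP[-> /ltW].
  - exact: L1_conull_square.
  - exact: measurable_obs_term.
  - move=> z /cyl1 z1; apply: le_trans (obs_term_geometric R i z) _.
    by rewrite ler_wpM2r ?invr_ge0 ?exprn_ge0// ler_piMr.
rewrite cG (eq_bigr _ (fun i _ => cG i)).
have main := main_term j (g j) (mu j) j1 gj Lj Ij; rewrite -/k -/d in main.
have low : `|\sum_(1 <= i < j) \int[mu j]_(z in half_open_square) obs_term R i z|
    <= k ^+ 2 * d / 32.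
  apply: le_trans (ler_norm_sum _ _ _) _.
  apply: (@le_trans _ _ (\sum_(1 <= i < j) 32 * d * (period i)%:R ^+ 2)).
    apply: ler_sum => i _.
    apply: le_trans (lower_frequency_terms j (g j) (mu j) gj Lj Ij i) _.
    by rewrite mulrAC.
  rewrite -mulr_sumr.
  have d0 : 0 <= 32 * d by rewrite mulr_ge0 ?delta_ge0.
  apply: le_trans (ler_wpM2l d0 (sum_sqr_period_le j j1)) _.
  rewrite -/k; lra.
set I1 := \int[mu j]_(z in @cylinder R) _.
set S := \sum_(1 <= i < j) _ in low *.
set M := \int[mu j]_(z in half_open_square) _ in main *.
move=> H1.
have k16 : 16 <= k by exact: natr_period_ge16.
have k0 : 0 < k by exact: natr_period_gt0.
have /andP[k4d _] := period_delta_bounds R j; rewrite -/k -/d in k4d.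
have d0 : 0 < d by exact: delta_gt0.
have tail : 64 / (k ^+ 4) ^+ 2 <= k ^+ 2 * d / 1024.
  rewrite ler_pdivrMr ?exprn_gt0//.
  have -> : k ^+ 2 * d / 1024 * (k ^+ 4) ^+ 2 = (k ^+ 4 * d) * (k ^+ 6 / 1024) by ring.
  have k6 : 16 ^+ 6 <= k ^+ 6 by rewrite lerXn2r ?nnegrE// ltW.
  apply: (@le_trans _ _ (1 * (k ^+ 6 / 1024))); first by lra.
  exact: (ler_wpM2r (divr_ge0 (exprn_ge0 6 (ltW k0)) (ler0n R 1024)) k4d).
(* Here k_j^4 d_j >= 1 turns k_j^2 d_j into a multiple of the square root: (k_j^2 d_j)^2 >= d_j. *)
have sq : Num.sqrt d <= k ^+ 2 * d.
  have kd0 : 0 <= k ^+ 2 * d by rewrite mulr_ge0 ?exprn_ge0 ?ltW.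
  rewrite -[leRHS]ger0_norm// -sqrtr_sqr ler_sqrt ?exprn_ge0//.
  have -> : (k ^+ 2 * d) ^+ 2 = (k ^+ 4 * d) * d by ring.
  by rewrite ler_peMl// ltW.
have q0 : 0 < k ^+ 2 * d by rewrite mulr_gt0// exprn_gt0.
apply: (@le_trans _ _ (I1 - I0)); last by rewrite distrC ler_norm.
move: H0 H1 low main tail sq q0; rewrite !ler_norml.
move: (64 / (k ^+ 4) ^+ 2) (k ^+ 2 * d) (Num.sqrt d) => T q s; lra.
Qed.
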